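(* Let $\mathbb X=\mathbb X_1\oplus\mathbb X_2$ be a Hilbert space, let $\mathcal A=\begin{bmatrix}\mathcal A_1\\ \mathcal A_2\end{bmatrix}:D(\mathcal A)\subseteq\mathbb X\to\mathbb X_1\oplus\mathbb X_2$ be a dissipative linear operator, and let $$\mathcal E=\begin{bmatrix}\mathcal E_1&0\\0&0\end{bmatrix},\qquad \mathcal Q=\begin{bmatrix}\mathcal Q_1&0\\0&\mathcal Q_2\end{bmatrix},$$ where $\mathcal E_1,\mathcal Q_1$ (on $\mathbb X_1$) and $\mathcal Q_2$ (on $\mathbb X_2$) are bounded and boundedly invertible and $\mathcal E_1^*\mathcal Q_1$ is coercive. Assume that the pair $(\mathcal E,\mathcal A\mathcal Q)$ is regular. Define $$\mathcal W_0=\left\{x_1\in\mathbb X_1\ \middle|\ \exists\,x_2\in\mathbb X_2:\ \begin{bmatrix}\mathcal Q_1x_1\\\mathcal Q_2x_2\end{bmatrix}\in D(\mathcal A)\text{ and }\mathcal A_2\begin{bmatrix}\mathcal Q_1x_1\\\mathcal Q_2x_2\end{bmatrix}=0\right\},$$ and let $\mathbb X_0\subseteq\mathbb X_1$ be the closure of $\mathcal W_0$ in $\mathbb X_1$. Equip $\mathbb X_0$ with the inner product $\langle x_1,\tilde x_1\rangle_{\mathcal E\mathcal Q}=\langle x_1,\mathcal E_1^*\mathcal Q_1\tilde x_1\rangle$. If $$\left\{y_1\in\mathbb X_0\ \middle|\ \exists\,x_2\in\mathbb X_2:\ \begin{bmatrix}0\\\mathcal Q_2x_2\end{bmatrix}\in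 D(\mathcal A)\text{ and }\mathcal A\begin{bmatrix}0\\\mathcal Q_2x_2\end{bmatrix}=\begin{bmatrix}\mathcal E_1y_1\\0\end{bmatrix}\right\}=\{0\},$$ then the operator $\mathcal A_{red}:D(\mathcal A_{red})\subset\mathbb X_0\to\mathbb X_0$ with domain $$D(\mathcal A_{red})=\left\{x_1\in\mathbb X_0\ \middle|\ \exists\,x_2\in\mathbb X_2:\ \begin{bmatrix}\mathcal Q_1x_1\\\mathcal Q_2x_2\end{bmatrix}\in D(\mathcal A),\ \mathcal A_2\begin{bmatrix}\mathcal Q_1x_1\\\mathcal Q_2x_2\end{bmatrix}=0,\ \mathcal E_1^{-1}\mathcal A_1\begin{bmatrix}\mathcal Q_1x_1\\\mathcal Q_2x_2\end{bmatrix}\in\mathbb X_0\right\}$$ and action $$\mathcal A_{red}x_1=\mathcal E_1^{-1}\mathcal A_1\begin{bmatrix}\mathcal Q_1x_1\\\mathcal Q_2x_2\end{bmatrix}$$ (with $x_2$ as in the definition of the domain) is well-defined and generates a contraction semigroup on $\mathbb X_0$.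
   Context: Hilbert spaces are complex; $\mathbb C^+=\{s\in\mathbb C:\operatorname{Re}s>0\}$. A linear operator $\mathcal A$ is dissipative if $\operatorname{Re}\langle\mathcal Ax,x\rangle\le0$ for all $x\in D(\mathcal A)$. A bounded operator $T$ is coercive if it is self-adjoint and there is $\kappa>0$ with $\langle Tx,x\rangle\ge\kappa\|x\|^2$ for all $x$. The operator $s\mathcal E-\mathcal A\mathcal Q$ has domain $\{x\in\mathbb X:\mathcal Qx\in D(\mathcal A)\}$; an operator is boundedly invertible if it is a bijection from its domain onto the whole space with bounded inverse. The pair $(\mathcal E,\mathcal A\mathcal Q)$ is regular if there exists $s\in\mathbb C^+$ such that $s\mathcal E-\mathcal A\mathcal Q$ is boundedly invertible. A contraction semigroup is a strongly continuous semigroup $(T(t))_{t\ge0}$ with $\|T(t)\|\le1$ for all $t\ge 0$. *)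

(* Defs.v *)
From HB Require Import structures.
From mathcomp Require Import all_boot all_order all_algebra sesquilinear complex.
From mathcomp Require Import all_classical all_reals topology normedtype.

Set Implicit Arguments.
Unset Strict Implicit.
Unset Printing Implicit Defensive.

Import Order.TTheory GRing.Theory Num.Theory.
Import numFieldNormedType.Exports.

Local Open Scope classical_set_scope.
Local Open Scope ring_scope.
Local Open Scope complex_scope.

HB.mixin Record NormedModule_hasDot (R : realType) V
    & NormedModule R[i] V := {
  hform : {dot V for Num.conj} ;
  hformE : forall x : V, hform x x = `|x| ^+ 2
}.

#[short(type="hilbertType")]
HB.structure Definition Hilbert (R : realType) :=
  {V of CompleteNormedModule R[i] V & NormedModule_hasDot R V}.

Definition hdot (R : realType) (H : hilbertType R) (x y : H) : R[i] := hform x y.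

Lemma hdotE (R : realType) (H : hilbertType R) (x : H) : hdot x x = `|x| ^+ 2.
Proof. exact: hformE. Qed.

Section DotNorm.
Variables (C : numClosedFieldType) (U : lmodType C).
Variable form : {dot U for Num.conj}.
Local Notation "''[' u , v ]" := (form u%R v%R) : ring_scope.
Local Notation "''[' u ]" := '[u, u]%R : ring_scope.

Lemma dot_conj (x y : U) : '[y, x] = ('[x, y])^*%R.
Proof. by rewrite (hermitian_subproof y x) expr0 mul1r. Qed.

Lemma dot_cauchy_schwarz (x y : U) : `|'[x, y]| <= sqrtC '[x] * sqrtC '[y].
Proof.
have [->|y0] := eqVneq y 0.
  by rewrite linear0 normr0 mulr_ge0 ?sqrtC_ge0 ?dnorm_ge0.
have yy0 : 0 < '[y] by rewrite dnorm_gt0.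
have yyr : ('[y])^*%R = '[y] by rewrite -dot_conj.
rewrite -sqrtCM ?nnegrE ?dnorm_ge0//.
rewrite -(@ler_pXn2r _ 2)// ?nnegrE ?sqrtC_ge0 ?mulr_ge0 ?dnorm_ge0//.
rewrite sqrtCK.
have := dnorm_ge0 form (x - ('[x, y] / '[y]) *: y).
have dE : '[x, ('[x, y] / '[y]) *: y] = `|'[x, y]| ^+ 2 / '[y].
  by rewrite linearZr_LR/= rmorphM/= fmorphV/= yyr normCK mulrAC [_^*%R * _]mulrC.
have nE : `|'[x, y] / '[y]| ^+ 2 * '[y] = `|'[x, y]| ^+ 2 / '[y].
  rewrite normrM normfV (gtr0_norm yy0) exprMn exprVn -mulrA; congr (_ * _).
  by rewrite expr2 invfM mulfVK ?gt_eqF.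
have q0 : 0 <= `|'[x, y]| ^+ 2 / '[y] by rewrite divr_ge0 ?exprn_ge0 ?(ltW yy0).
rewrite dnormB dnormZ dE nE (geC0_conj q0).
by rewrite opprD addrA addrK subr_ge0 ler_pdivrMr.
Qed.

Lemma dot_ler_normD (x y : U) :
  sqrtC '[x + y] <= sqrtC '[x] + sqrtC '[y].
Proof.
have s0 u : 0 <= sqrtC '[u] by rewrite sqrtC_ge0 dnorm_ge0.
rewrite -(@ler_pXn2r _ 2)// ?nnegrE ?addr_ge0// sqrrD !sqrtCK dnormD/=.
rewrite -addrA (addrC '[y]) addrA lerD2r lerD2l -dot_conj.
have xyr : '[x, y] + '[y, x] \is Num.real.
  by apply/CrealP; rewrite rmorphD/= -!dot_conj addrC.
apply: le_trans (real_ler_norm xyr) _; apply: le_trans (ler_normD _ _) _.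
by rewrite mulr2n lerD// ?dot_cauchy_schwarz// mulrC dot_cauchy_schwarz.
Qed.

End DotNorm.

(* The library norm on X1 * X2 is the max norm, so the orthogonal direct sum
   is an alias of the product, normed by its own inner product. *)
Definition hsum (R : realType) (X1 X2 : hilbertType R) : Type := (X1 * X2)%type.

Notation "X1 \oplus X2" := (hsum X1 X2)
  (at level 50, left associativity) : type_scope.

Section DirectSum.
Variables (R : realType) (X1 X2 : hilbertType R).

HB.instance Definition _ := GRing.Lmodule.copy (hsum X1 X2) (X1 * X2)%type.

Definition hsum_dot (x y : hsum X1 X2) : R[i] :=
  hform x.1 y.1 + hform x.2 y.2.

Let hsum_dot_bilinear : bilinear_for *%R (Num.conj \; *%R) hsum_dot.
Proof.
split=> [y|x] a u v; rewrite /hsum_dot /=.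
  by rewrite !linearPl mulrDr addrACA.
by rewrite !linearP/= mulrDr addrACA.
Qed.

HB.instance Definition _ := bilinear_isBilinear.Build
  R[i] (hsum X1 X2) (hsum X1 X2) R[i] *%R (Num.conj \; *%R) hsum_dot
  hsum_dot_bilinear.

Let hsum_dot_herm x y :
  hsum_dot x y = (-1) ^+ false * Num.conj (hsum_dot y x).
Proof. by rewrite expr0 mul1r rmorphD/= -!dot_conj. Qed.

HB.instance Definition _ := isHermitianSesquilinear.Build
  R[i] (hsum X1 X2) false Num.conj hsum_dot hsum_dot_herm.

Let hsum_dot_gt0 x : x != 0 -> 0 < hsum_dot x x.
Proof.
case: x => x1 x2 /eqP x0; rewrite /hsum_dot/= lt_def addr_ge0 ?dnorm_ge0// andbT.
rewrite paddr_eq0 ?dnorm_ge0// !dnorm_eq0.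
by apply/negP => /andP[/eqP x10 /eqP x20]; apply: x0; rewrite x10 x20.
Qed.

HB.instance Definition _ := isDotProduct.Build
  R[i] (hsum X1 X2) hsum_dot hsum_dot_gt0.

Let hsum_norm (x : hsum X1 X2) : R[i] := sqrtC (hsum_dot x x).

Let hsum_normD x y : hsum_norm (x + y) <= hsum_norm x + hsum_norm y.
Proof. exact: dot_ler_normD. Qed.

Let hsum_normZ (a : R[i]) x : hsum_norm (a *: x) = `|a| * hsum_norm x.
Proof.
rewrite /hsum_norm dnormZ rootCMl ?exprn_ge0//.
by rewrite sqrCK.
Qed.

Let hsum_norm0 x : hsum_norm x = 0 -> x = 0.
Proof. by move=> /eqP; rewrite sqrt_dnorm_eq0 => /eqP. Qed.

HB.instance Definition _ := Lmodule_isNormed.Build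
  R[i] (hsum X1 X2) hsum_normD hsum_normZ hsum_norm0.

Let hsum_normE (x : hsum X1 X2) : hsum_dot x x = `|x| ^+ 2.
Proof. by rewrite sqrtCK. Qed.

Let hsum_norm_ge1 (x : hsum X1 X2) : `|x.1| <= `|x|.
Proof.
rewrite -(@ler_pXn2r _ 2)// ?nnegrE// -hsum_normE -hformE.
by rewrite lerDl dnorm_ge0.
Qed.

Let hsum_norm_ge2 (x : hsum X1 X2) : `|x.2| <= `|x|.
Proof.
rewrite -(@ler_pXn2r _ 2)// ?nnegrE// -hsum_normE -hformE.
by rewrite lerDr dnorm_ge0.
Qed.

Let hsum_norm_le (x : hsum X1 X2) : `|x| <= `|x.1| + `|x.2|.
Proof.
rewrite -(@ler_pXn2r _ 2)// ?nnegrE ?addr_ge0// -hsum_normE.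
by rewrite /hsum_dot !hformE sqrrD lerD2r lerDl mulrn_wge0 ?mulr_ge0.
Qed.

Let hsum_complete (F : set_system (hsum X1 X2)) :
  ProperFilter F -> cauchy F -> cvg F.
Proof.
move=> FF /cauchyP Fc.
have c1 : cvg (fst @ F : set_system X1).
  apply: cauchy_cvg; apply/cauchyP => e e0; have [x Fx] := Fc e e0.
  exists x.1; rewrite /fmap/=; apply: (@filterS _ F _ _ _ _ Fx) => y.
  rewrite -!ball_normE/=; apply: le_lt_trans.
  exact: (hsum_norm_ge1 (x - y)).
have c2 : cvg (snd @ F : set_system X2).
  apply: cauchy_cvg; apply/cauchyP => e e0; have [x Fx] := Fc e e0.
  exists x.2; rewrite /fmap/=; apply: (@filterS _ F _ _ _ _ Fx) => y.
  rewrite -!ball_normE/=; apply: le_lt_trans.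
  exact: (hsum_norm_ge2 (x - y)).
have /cvg_ex[l1 /cvgrPdist_lt l1P] := c1.
have /cvg_ex[l2 /cvgrPdist_lt l2P] := c2.
apply/cvg_ex; exists ((l1, l2) : hsum X1 X2); apply/cvgrPdist_lt => e e0.
near=> x.
apply: le_lt_trans (hsum_norm_le ((l1, l2) - x)) _; rewrite /= (splitr e).
by rewrite ltrD//; near: x; [apply: l1P|apply: l2P]; rewrite divr_gt0.
Unshelve. all: by end_near. Qed.

HB.instance Definition _ := Uniform_isComplete.Build (hsum X1 X2) hsum_complete.

HB.instance Definition _ := NormedModule_hasDot.Build
  R (hsum X1 X2) hsum_normE.

End DirectSum.
Section Operators.
Variable R : realType.

(* Unbounded operators are total functions with a separate domain; their
   values off the domain are irrelevant. *)
Definition linear_on (V W : lmodType R[i]) (D : set V) (A : V -> W) : Prop :=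
  [/\ D 0,
      forall (a : R[i]) x y, D x -> D y -> D (a *: x + y) &
      forall (a : R[i]) x y, D x -> D y -> A (a *: x + y) = a *: A x + A y].

Definition bounded_op (V W : normedModType R[i]) (T : V -> W) : Prop :=
  exists M : R, forall x, `|T x| <= M%:C * `|x|.

Definition boundedly_invertible (V W : normedModType R[i])
    (D : set V) (P : V -> W) : Prop :=
  set_bij D [set: W] P /\ bounded_op ('pinv_(fun=> 0) D P).

Definition dissipative (H : hilbertType R) (D : set H) (A : H -> H) : Prop :=
  forall x, D x -> 'Re (hdot (A x) x) <= 0.

(* For bounded T, the set is a singleton by the Riesz representation theorem. *)
Definition adjoint (V W : hilbertType R) (T : V -> W) (y : W) : V :=
  xget 0 [set z | forall x, hdot (T x) y = hdot x z].

Definition self_adjoint (H : hilbertType R) (T : H -> H) : Prop :=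
  forall x y, hdot (T x) y = hdot x (T y).

Definition coercive (H : hilbertType R) (T : H -> H) : Prop :=
  self_adjoint T /\
  exists2 k : R, 0 < k & forall x, k%:C * `|x| ^+ 2 <= hdot (T x) x.

Definition regular_pair (H : hilbertType R) (E : H -> H)
    (D : set H) (B : H -> H) : Prop :=
  exists2 s : R[i], 0 < 'Re s & boundedly_invertible D (fun x => s *: E x - B x).

Definition diag_op (X1 X2 : hilbertType R) (T1 : X1 -> X1) (T2 : X2 -> X2)
    (x : X1 \oplus X2) : X1 \oplus X2 := (T1 x.1, T2 x.2).

End Operators.

(* A subspace S of V carrying its own inner product ip: operators on S are
   functions on V whose values off S are irrelevant. *)
Section Semigroup.
Variables (R : realType) (V : lmodType R[i]).
Variables (S : set V) (ip : V -> V -> R[i]).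

Definition ipnorm (x : V) : R := Num.sqrt (complex.Re (ip x x)).

Record contraction_semigroup (T : R -> V -> V) : Prop := {
  semigroup_fun : forall t, 0 <= t -> set_fun S S (T t) ;
  semigroup_linear : forall t, 0 <= t -> linear_on S (T t) ;
  semigroup0 : forall x, S x -> T 0 x = x ;
  semigroupD : forall s t x, 0 <= s -> 0 <= t -> S x ->
    T (s + t) x = T s (T t x) ;
  semigroup_cvg : forall x, S x -> ipnorm (T t x - x) @[t --> 0^'+] --> 0 ;
  semigroup_contraction : forall t x, 0 <= t -> S x ->
    ipnorm (T t x) <= ipnorm x
}.

Definition is_generator (T : R -> V -> V) (D : set V) (B : V -> V) : Prop :=
  [/\ D `<=` S, set_fun D S B &
      forall x y, S x -> S y ->
        (ipnorm ((t^-1)%:C *: (T t x - x) - y) @[t --> 0^'+] --> 0) <->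
        (D x /\ B x = y)].

Definition generates_contraction_semigroup (D : set V) (B : V -> V) : Prop :=
  exists2 T, contraction_semigroup T & is_generator T D B.

End Semigroup.

(* Main.v *)
(* If (s E - A Q) x = (E1 f, 0) with f in X0, then the first component of x lies
   in W0 and solves (s - Ared) x1 = f; so regularity makes s - Ared surjective on
   X0, while dissipativity of A makes Ared dissipative for the inner product
   <E1 x, Q1 y>, and the kernel condition makes Ared single-valued. The rest is
   the Lumer-Phillips theorem in a Hilbert space, without assuming a dense
   domain. Surjectivity spreads from s to all positive reals by a fixed-point
   argument. The resolvents J h = (1 - h A)^-1 are contractions, and
   |J m x - J l x|^2 <= |x - J l x|^2 - |x - J m x|^2 for m < l shows that
   J h x converges as h -> 0; its limit is x because A is single-valued. On the
   dense set D(A^2) the steps J a (J b x) and J (a + b) x differ by O((a + b)^2),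
   hence the backward Euler iterates J (t / 2^n)^(2^n) x converge, and their
   limit is the semigroup. *)
Require Import Defs.
From HB Require Import structures.
From mathcomp Require Import all_boot all_order all_algebra sesquilinear complex.
From mathcomp Require Import all_classical all_reals topology normedtype.
From mathcomp Require Import sequences ring lra.

Set Implicit Arguments.
Unset Strict Implicit.
Unset Printing Implicit Defensive.

Import Order.TTheory GRing.Theory Num.Theory.
Import numFieldNormedType.Exports.

Local Open Scope classical_set_scope.
Local Open Scope ring_scope.
Local Open Scope complex_scope.

(** * Inner products *)

Lemma subrACA (V : zmodType) (a b c d : V) :
  (a - b) - (c - d) = (a - c) - (b - d).
Proof. by rewrite !opprD addrACA. Qed.

(** The axioms concern a bare function, so that they apply both to the energy product and to its
    restriction to a subspace, with no second norm structure on [V]. *)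
Record inner_product (R : realType) (V : lmodType R[i]) (ip : V -> V -> R[i]) :
    Prop := InnerProduct {
  ip_linear : forall a x y z, ip (a *: x + y) z = a * ip x z + ip y z ;
  ip_conj : forall x y, ip y x = (ip x y)^* ;
  ip_ge0 : forall x, 0 <= ip x x ;
  ip_eq0 : forall x, ip x x = 0 -> x = 0
}.

(** [V] is a bare module without a topology, so completeness is phrased with Cauchy sequences for
    [ipnorm]. *)
Definition ip_complete (R : realType) (V : lmodType R[i])
    (ip : V -> V -> R[i]) : Prop :=
  forall u : nat -> V,
    (forall e : R, 0 < e -> exists N, forall m n, (N <= m)%N -> (N <= n)%N ->
      ipnorm ip (u m - u n) < e) ->
    exists l, ipnorm ip (u n - l) @[n --> \oo] --> 0.

Section InnerProduct.
Variables (R : realType) (V : lmodType R[i]) (ip : V -> V -> R[i]).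
Hypothesis ipP : inner_product ip.

Local Notation nrm := (ipnorm ip).

(** A symmetric real bilinear form that determines the norm; dissipativity is a statement about it
    alone. *)
Definition rip (x y : V) : R := complex.Re (ip x y).

Lemma ripDl x y z : rip (x + y) z = rip x z + rip y z.
Proof.
rewrite /rip -[x in ip (x + _)]scale1r (ip_linear ipP) mul1r.
by case: (ip x z) (ip y z) => [a b] [].
Qed.

Lemma ripC x y : rip x y = rip y x.
Proof. by rewrite /rip (ip_conj ipP); case: ip. Qed.

Lemma rip0l y : rip 0 y = 0.
Proof. by have := ripDl 0 0 y; rewrite addr0; lra. Qed.

Lemma ip_scale a x y : ip (a *: x) y = a * ip x y.
Proof.
rewrite -[a *: x]addr0 (ip_linear ipP) -[X in _ + X]mul1r.
suff -> : ip 0 y = 0 by rewrite mulr0 addr0.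
have := ip_linear ipP 1 0 0 y; rewrite scaler0 addr0 mul1r => /eqP.
by rewrite addrC -subr_eq subrr => /eqP.
Qed.

Lemma ripZl a x y : rip (a%:C *: x) y = a * rip x y.
Proof. by rewrite /rip ip_scale; case: ip => b c /=; rewrite mul0r subr0. Qed.

Lemma ripZr a x y : rip x (a%:C *: y) = a * rip x y.
Proof. by rewrite ripC ripZl ripC. Qed.

Lemma ripNl x y : rip (- x) y = - rip x y.
Proof. by have := ripDl x (- x) y; rewrite subrr rip0l; lra. Qed.

Lemma ripDr x y z : rip x (y + z) = rip x y + rip x z.
Proof. by rewrite ripC ripDl !(ripC x). Qed.

Lemma ripNr x y : rip x (- y) = - rip x y.
Proof. by rewrite ripC ripNl ripC. Qed.

Definition ripE := (ripDl, ripDr, ripNl, ripNr, ripZl, ripZr).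

Lemma rip_ge0 x : 0 <= rip x x.
Proof. by have := ip_ge0 ipP x; rewrite lecE => /andP[]. Qed.

Lemma rip_eq0 x : rip x x = 0 -> x = 0.
Proof.
move=> x0; apply: (ip_eq0 ipP); have := ip_ge0 ipP x; rewrite lecE /=.
by move: x0; rewrite /rip; case: ip => a b /= -> /andP[/eqP-> _].
Qed.

Lemma ip_real x : complex.Im (ip x x) = 0.
Proof. by have := ip_ge0 ipP x; rewrite lecE => /andP[/eqP]. Qed.

Lemma rip_scale_self a x : rip (a *: x) x = complex.Re a * rip x x.
Proof.
rewrite /rip ip_scale; have := ip_real x.
by case: a (ip x x) => b c [d e] /= ->; rewrite mulr0 subr0.
Qed.

Lemma nrm_ge0 x : 0 <= nrm x.
Proof. exact: sqrtr_ge0. Qed.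

Lemma nrm_sqr x : nrm x ^+ 2 = rip x x.
Proof. by rewrite sqr_sqrtr ?rip_ge0. Qed.

Lemma nrm0 : nrm 0 = 0.
Proof. by rewrite /ipnorm -/(rip 0 0) rip0l sqrtr0. Qed.

Lemma nrm_eq0 x : nrm x = 0 -> x = 0.
Proof. by move=> x0; apply: rip_eq0; rewrite -nrm_sqr x0 expr0n. Qed.

Lemma nrmN x : nrm (- x) = nrm x.
Proof. by rewrite /ipnorm -!/(rip _ _) ripNl ripNr opprK. Qed.

Lemma nrmC x y : nrm (x - y) = nrm (y - x).
Proof. by rewrite -nrmN opprB. Qed.

Lemma nrmZ a x : nrm (a *: x) = complex.Re `|a| * nrm x.
Proof.
rewrite normc_def /=.
rewrite /ipnorm -sqrtrM ?addr_ge0 ?sqr_ge0//; congr Num.sqrt.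
rewrite ip_scale (ip_conj ipP) ip_scale; have := ip_real x.
by case: a (ip x x) => b c [d e] /= ->; ring.
Qed.

Lemma nrmZr a x : 0 <= a -> nrm (a%:C *: x) = a * nrm x.
Proof. by move=> a0; rewrite nrmZ ger0_norm ?ler0c. Qed.

(** Cauchy-Schwarz: expand the square of ‖y‖ x - ‖x‖ y, which is nonnegative, and divide by ‖x‖ ‖y‖.
    Vectors of norm 0 are treated apart because of this division. *)
Lemma rip_le x y : rip x y <= nrm x * nrm y.
Proof.
have [y0|yn0] := eqVneq (nrm y) 0.
  by rewrite (nrm_eq0 y0) ripC rip0l nrm0 mulr0.
have y0 : 0 < nrm y by rewrite lt_def yn0 nrm_ge0.
have := rip_ge0 ((nrm y)%:C *: x - (nrm x)%:C *: y).
rewrite !ripE (ripC y x) -!nrm_sqr => h.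
have [x0|xn0] := eqVneq (nrm x) 0.
  by rewrite (nrm_eq0 x0) rip0l nrm0 mul0r.
have x0 : 0 < nrm x by rewrite lt_def xn0 nrm_ge0.
have xy0 := mulr_gt0 x0 y0; rewrite -(ler_pM2l xy0); nra.
Qed.

Lemma nrmD x y : nrm (x + y) <= nrm x + nrm y.
Proof.
rewrite -(@ler_pXn2r _ 2)// ?nnegrE ?addr_ge0 ?nrm_ge0//.
rewrite nrm_sqr !ripE (ripC y x) -!nrm_sqr.
by have := rip_le x y; nra.
Qed.

Lemma nrmB x y : nrm (x - y) <= nrm x + nrm y.
Proof. by rewrite -(nrmN y) nrmD. Qed.

Lemma nrm_dist x y z : nrm (x - z) <= nrm (x - y) + nrm (y - z).
Proof. by have := nrmD (x - y) (y - z); rewrite addrA subrK. Qed.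

Lemma nrm_small_eq x y : (forall e, 0 < e -> nrm (x - y) <= e) -> x = y.
Proof.
move=> h; apply/eqP; rewrite -subr_eq0; apply/eqP/nrm_eq0/eqP.
rewrite eq_le nrm_ge0 andbT; apply/ler_addgt0Pr => e /h; rewrite add0r; exact.
Qed.

(** Closed balls are stable under limits; this turns each estimate on the Euler iterates into one on
    the semigroup. *)
Lemma nrm_lim_le u l y C : nrm (u n - l) @[n --> \oo] --> 0 ->
  (\forall n \near \oo, nrm (u n - y) <= C) -> nrm (l - y) <= C.
Proof.
move=> ul uC; apply/ler_addgt0Pr => e e0.
have /cvgrPdist_lt/(_ e e0) ule := ul.
near \oo => n.
apply: le_trans (nrm_dist l (u n) y) _; rewrite addrC lerD//; first by near: n.
rewrite nrmC ltW//; have : `|0 - nrm (u n - l)| < e by near: n.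
by rewrite sub0r normrN ger0_norm ?nrm_ge0.
Unshelve. all: by end_near. Qed.

Lemma nrm_lim_unique u l l' : nrm (u n - l) @[n --> \oo] --> 0 ->
  nrm (u n - l') @[n --> \oo] --> 0 -> l = l'.
Proof.
move=> ul ul'; apply: nrm_small_eq => e e0; apply: nrm_lim_le ul _.
move/cvgrPdist_lt/(_ e e0) : ul'; apply: filterS => n.
by rewrite sub0r normrN ger0_norm ?nrm_ge0// => /ltW.
Qed.

Lemma nrm_cvg_le u (f : nat -> R) l :
  (\forall n \near \oo, nrm (u n - l) <= f n) -> f n @[n --> \oo] --> 0 ->
  nrm (u n - l) @[n --> \oo] --> 0.
Proof.
move=> uf f0; apply: (squeeze_cvgr _ (cvg_cst 0) f0).
by apply: filterS uf => n; rewrite nrm_ge0.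
Qed.

(** * Sequences with geometrically decreasing increments *)

Section Complete.
Hypothesis ipc : ip_complete ip.

Lemma geometric_cvg u (C q : R) : 0 <= q < 1 ->
  (forall n, nrm (u n.+1 - u n) <= C * q ^+ n) ->
  exists l, nrm (u n - l) @[n --> \oo] --> 0.
Proof.
move=> /andP[q0 q1] uC.
have C0 : 0 <= C.
  by have := uC 0%N; rewrite expr0 mulr1; apply: le_trans (nrm_ge0 _).
have uD m k : nrm (u (m + k)%N - u m) * (1 - q) <= C * q ^+ m.
  (* Keeping the partial geometric sum on the right gives a bound that induction on [k] can
     carry. *)
  have : nrm (u (m + k)%N - u m) * (1 - q) <= C * (q ^+ m - q ^+ (m + k)).
    elim: k => [|k IH]; first by rewrite addn0 !subrr nrm0 mul0r mulr0.
    have := nrm_dist (u (m + k.+1)%N) (u (m + k)%N) (u m).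
    have := uC (m + k)%N; rewrite addnS exprS; nra.
  move=> h; apply: le_trans h _; rewrite ler_wpM2l// gerBl exprn_ge0//.
apply: ipc => e e0.
have : C * q ^+ n @[n --> \oo] --> 0.
  rewrite -[0](mulr0 C); apply: cvgMr; apply: cvg_expr.
  by rewrite ger0_norm.
move=> /cvgrPdist_lt/(_ (e / 2 * (1 - q))).
case=> [|N _ hN]; first by rewrite mulr_gt0 ?divr_gt0// subr_gt0.
have {}hN : C * q ^+ N < e / 2 * (1 - q).
  have := hN N (leqnn N); rewrite /= sub0r normrN ger0_norm//.
  by rewrite mulr_ge0 ?exprn_ge0.
have hu m : (N <= m)%N -> nrm (u m - u N) < e / 2.
  move=> /subnKC <-; rewrite -(@ltr_pM2r _ (1 - q)) ?subr_gt0//.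
  exact: le_lt_trans (uD _ _) hN.
exists N => m n /hu um /hu un; apply: le_lt_trans (nrm_dist _ (u N) _) _.
by rewrite [ltRHS]splitr ltrD// nrmC.
Qed.

End Complete.
End InnerProduct.

(** * Resolvents of dissipative operators *)

Section LinearOn.
Variables (R : realType) (V W : lmodType R[i]) (D : set V) (A : V -> W).
Hypothesis linA : linear_on D A.

Lemma linear_on_dom0 : D 0. Proof. by case: linA. Qed.

Lemma linear_on_domD x y : D x -> D y -> D (x + y).
Proof. by case: linA => _ + _ Dx Dy => /(_ 1 x y Dx Dy); rewrite scale1r. Qed.

Lemma linear_on_domZ a x : D x -> D (a *: x).
Proof. by case: linA => D0 + _ Dx => /(_ a x 0 Dx D0); rewrite addr0. Qed.

Lemma linear_on_domB x y : D x -> D y -> D (x - y).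
Proof.
by move=> Dx Dy; apply: linear_on_domD => //; rewrite -scaleN1r;
  apply: linear_on_domZ.
Qed.

Lemma linear_onD x y : D x -> D y -> A (x + y) = A x + A y.
Proof. by case: linA => _ _ + Dx Dy => /(_ 1 x y Dx Dy); rewrite !scale1r. Qed.

Lemma linear_on0 : A 0 = 0.
Proof.
have /eqP := linear_onD linear_on_dom0 linear_on_dom0.
by rewrite addr0 addrC -subr_eq subrr => /eqP.
Qed.

Lemma linear_onZ a x : D x -> A (a *: x) = a *: A x.
Proof.
case: linA => D0 _ + Dx => /(_ a x 0 Dx D0); rewrite linear_on0 !addr0; exact.
Qed.

Lemma linear_onB x y : D x -> D y -> A (x - y) = A x - A y.
Proof.
case: linA => _ _ + Dx Dy => /(_ (-1) y x Dy Dx).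
by rewrite !scaleN1r ![- _ + _]addrC.
Qed.

End LinearOn.

(** * Range of s - A for s in the right half-plane *)

Section Resolvent.
Variables (R : realType) (V : lmodType R[i]) (ip : V -> V -> R[i]).
Hypotheses (ipP : inner_product ip) (ipc : ip_complete ip).
Variables (D : set V) (A : V -> V).
Hypotheses (linA : linear_on D A).
Hypothesis disA : forall x, D x -> rip ip (A x) x <= 0.

Local Notation nrm := (ipnorm ip).

(** Only surjectivity is recorded: for Re s > 0, [dissipative_bound] yields injectivity and the
    bound 1 / Re s on the inverse. *)
Definition resolvent_at (s : R[i]) : Prop :=
  forall f, exists2 x, D x & s *: x - A x = f.

(** Pairing s x - A x with x gives at least Re s ‖x‖^2; Cauchy-Schwarz and division by ‖x‖
    finish. *)
Lemma dissipative_bound (s : R[i]) x : D x ->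
  complex.Re s * nrm x <= nrm (s *: x - A x).
Proof.
move=> Dx; have := rip_le ipP (s *: x - A x) x.
rewrite !ripE// rip_scale_self// -(nrm_sqr ipP).
have := disA Dx; have [x0|xn0] := eqVneq (nrm x) 0.
  by move=> *; rewrite x0 mulr0 nrm_ge0.
have x0 : 0 < nrm x by rewrite lt_def xn0 nrm_ge0.
by move=> h1 h2; rewrite -(ler_pM2r x0); lra.
Qed.

Lemma resolventB (s : R[i]) x y : D x -> D y ->
  s *: (x - y) - A (x - y) = (s *: x - A x) - (s *: y - A y).
Proof.
by move=> Dx Dy; rewrite (linear_onB linA)// scalerBr subrACA.
Qed.

(* Fixed-point iteration for [x = (s - A)^-1 (f + (s - z) x)]. *)
Lemma resolvent_at_near (s z : R[i]) : resolvent_at s ->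
  complex.Re `|s - z| < complex.Re s -> resolvent_at z.
Proof.
move=> rs zs f.
have /boolp.choice[S SP] g : exists x, D x /\ s *: x - A x = g.
  by have [x] := rs g; exists x.
set q := complex.Re `|s - z| in zs.
have q0 : 0 <= q by have := normr_ge0 (s - z); rewrite lecE => /andP[].
have s0 : 0 < complex.Re s by exact: le_lt_trans zs.
have SL g h : nrm (S g - S h) <= (complex.Re s)^-1 * nrm (g - h).
  have [[Dg eg] [Dh eh]] := (SP g, SP h).
  rewrite ler_pdivlMl//.
  have := dissipative_bound s (linear_on_domB linA Dg Dh).
  by rewrite resolventB// eg eh.
pose F x := S (f + (s - z) *: x).
(* By [SL] the map [F] contracts with factor |s - z| / Re s, which is below 1 by assumption. *)
have FL x y : nrm (F x - F y) <= q / complex.Re s * nrm (x - y).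
  apply: le_trans (SL _ _) _.
  by rewrite opprD addrACA subrr add0r -scalerBr nrmZ// mulrA [_ * q]mulrC.
pose u n := iter n F 0.
have qs : 0 <= q / complex.Re s < 1.
  by rewrite divr_ge0 ?(ltW s0)//= ltr_pdivrMr// mul1r.
have uS n : nrm (u n.+1 - u n) <= nrm (F 0) * (q / complex.Re s) ^+ n.
  elim: n => [|n IH]; first by rewrite expr0 mulr1 subr0.
  rewrite exprS mulrCA; apply: le_trans (FL _ _) _.
  by apply: ler_wpM2l IH; case/andP: qs.
have [l ul] := geometric_cvg ipP ipc qs uS.
have lF : F l = l.
  apply: (@nrm_lim_unique _ _ _ ipP (fun n => u n.+1)); last first.
    by move: ul; rewrite -cvg_shiftS.
  apply: (nrm_cvg_le (f := fun n => q / complex.Re s * nrm (u n - l))).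
    by apply: nearW => n; apply: FL.
  by rewrite -[0](mulr0 (q / complex.Re s)); apply: cvgMr.
exists l; first by rewrite -lF; case: (SP (f + (s - z) *: l)).
have [_] := SP (f + (s - z) *: l); rewrite -/(F l) lF => h.
have -> : f = (s *: l - A l) - (s - z) *: l by rewrite h addrK.
by rewrite scalerBl opprB [RHS]addrC addrA subrK.
Qed.

(** Moving right never decreases the real part, so a step length r / n below Re s stays admissible
    for [resolvent_at_near] at each of the n steps. *)
Lemma resolvent_at_shift (s : R[i]) (r : R) : 0 < complex.Re s -> 0 <= r ->
  resolvent_at s -> resolvent_at (s + r%:C).
Proof.
move=> s0 r0 rs; pose n := (Num.trunc (r / complex.Re s)).+1.
have n0 : 0 < n%:R :> R by rewrite ltr0n.
have hr : r / n%:R < complex.Re s.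
  by rewrite ltr_pdivrMr// mulrC -ltr_pdivrMr// truncnS_gt.
have rn0 : 0 <= r / n%:R by rewrite divr_ge0// ltW.
suff h k : resolvent_at (s + (r / n%:R * k%:R)%:C).
  by have := h n; rewrite divfK// gt_eqF.
elim: k => [|k IH]; first by rewrite mulr0 addr0.
apply: (resolvent_at_near IH).
have -> : s + (r / n%:R * k%:R)%:C - (s + (r / n%:R * k.+1%:R)%:C) =
    - (r / n%:R)%:C.
  by rewrite -addn1 natrD mulrDr mulr1 rmorphD/=; ring.
rewrite normrN ger0_norm ?ler0c//= raddfD/=.
by apply: lt_le_trans hr _; rewrite lerDl mulr_ge0.
Qed.

(* Shift [s] to the right until its real part exceeds [`|Im s|], move to the real
   axis, and come back to [l]. *)
Lemma resolvent_at_real (s : R[i]) (l : R) : 0 < complex.Re s -> 0 < l ->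
  resolvent_at s -> resolvent_at l%:C.
Proof.
move=> s0 l0 rs; pose r := `|complex.Im s| + l.
have r0 : 0 <= r by rewrite addr_ge0// ltW.
have rL : resolvent_at (complex.Re s + r)%:C.
  apply: (resolvent_at_near (resolvent_at_shift s0 r0 rs)).
  case: s @r s0 rs r0 => a b r a0 _ r0.
  rewrite normc_def /= subrr expr0n add0r addr0 subr0 sqrtr_sqr /r/=.
  by move: a0 => /=; lra.
apply: (resolvent_at_near rL).
have b0 := normr_ge0 (complex.Im s).
have h : 0 <= complex.Re s + r - l by rewrite /r; lra.
rewrite -rmorphB ger0_norm ?ler0c//.
by rewrite /=; lra.
Qed.

End Resolvent.

(** * Backward Euler steps *)

Section ImplicitEuler.
Variables (R : realType) (V : lmodType R[i]) (ip : V -> V -> R[i]).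
Hypotheses (ipP : inner_product ip) (ipc : ip_complete ip).
Variables (D : set V) (A : V -> V).
Hypotheses (linA : linear_on D A).
Hypothesis disA : forall x, D x -> rip ip (A x) x <= 0.
Hypothesis ranA : forall l : R, 0 < l -> resolvent_at D A l%:C.

Local Notation nrm := (ipnorm ip).

(* [(1 - h A)^-1], extended by the identity to [h <= 0]. *)
Definition euler_step (h : R) (x : V) : V :=
  if 0 < h then xget 0 [set z | D z /\ z - h%:C *: A z = x] else x.
Local Notation J := euler_step.

(** Multiply the resolvent equation at 1 / h with right-hand side x / h by h. *)
Lemma euler_step_spec h x : 0 < h ->
  D (J h x) /\ J h x - h%:C *: A (J h x) = x.
Proof.
move=> h0; rewrite /J h0.
have hV0 : 0 < h^-1 by rewrite invr_gt0.
have [z Dz ez] := ranA hV0 (h^-1%:C *: x).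
case: xgetP => [y _ //|/(_ z)[]]; split=> //.
have hh : h%:C * h^-1%:C = 1 by rewrite -rmorphM/= divff ?gt_eqF.
have := congr1 (fun v => h%:C *: v) ez.
by rewrite /= scalerBr !scalerA hh !scale1r.
Qed.

Lemma euler_step_id x : J 0 x = x.
Proof. by rewrite /J ltxx. Qed.

(** In the expansion of ‖z - h A z‖^2 the cross term -2 h Re <A z, z> and the term h^2 ‖A z‖^2 are
    both nonnegative. *)
Lemma dissipative_expand h z : 0 <= h -> D z -> nrm z <= nrm (z - h%:C *: A z).
Proof.
move=> h0 Dz; rewrite -(@ler_pXn2r _ 2)// ?nnegrE ?nrm_ge0// !nrm_sqr// !ripE//.
have := disA Dz; rewrite (ripC ipP z).
have := rip_ge0 ipP (A z); nra.
Qed.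

Lemma euler_step_unique h x z : 0 <= h -> D z -> z - h%:C *: A z = x ->
  J h x = z.
Proof.
rewrite le_eqVlt => /predU1P[<- _|h0 Dz ez].
  by rewrite scale0r subr0 euler_step_id.
have [DJ eJ] := euler_step_spec x h0.
apply/eqP; rewrite -subr_eq0; apply/eqP/(nrm_eq0 ipP)/eqP.
rewrite eq_le nrm_ge0 andbT.
apply: le_trans (dissipative_expand (ltW h0) (linear_on_domB linA DJ Dz)) _.
by rewrite (linear_onB linA)// scalerBr subrACA eJ ez subrr nrm0.
Qed.

Lemma euler_step_dom h x : D x -> D (J h x).
Proof.
have [h0|h0] := boolP (0 < h); first by have [] := euler_step_spec x h0.
by rewrite /J (negbTE h0).
Qed.

Lemma euler_step_linear h : linear (J h).
Proof.
move=> a x y; have [h0|h0] := boolP (0 < h); last by rewrite /J (negbTE h0).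
have [Dx ex] := euler_step_spec x h0; have [Dy ey] := euler_step_spec y h0.
apply: euler_step_unique; rewrite ?ltW//.
  by apply: (linear_on_domD linA) => //; apply: (linear_on_domZ linA).
rewrite (linear_onD linA)//; last exact: (linear_on_domZ linA).
rewrite (linear_onZ linA)// -[in RHS]ex -[in RHS]ey scalerBr scalerDr opprD.
by rewrite addrACA !scalerA [a * _]mulrC.
Qed.

Lemma euler_step_le h x : nrm (J h x) <= nrm x.
Proof.
have [h0|h0] := boolP (0 < h); last by rewrite /J (negbTE h0).
have [Dx ex] := euler_step_spec x h0.
by rewrite -[in leRHS]ex dissipative_expand ?ltW.
Qed.

(** For x in [D] the vector h A (J h x) = J h x - x lies in [D], so A may be applied to J h x - h A
    (J h x) = x term by term; uniqueness of the step concludes. *)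
Lemma euler_step_comm_gen h x : 0 <= h -> D x -> A (J h x) = J h (A x).
Proof.
rewrite le_eqVlt => /predU1P[<-|h0]; first by rewrite !euler_step_id.
move=> Dx; have [DJ eJ] := euler_step_spec x h0.
have e : h%:C *: A (J h x) = J h x - x.
  by rewrite -{3}eJ opprB addrC subrK.
have hV : h^-1%:C * h%:C = 1 by rewrite -rmorphM/= mulVf ?gt_eqF.
have DA : D (A (J h x)).
  rewrite -[A _]scale1r -hV -scalerA e.
  by apply: (linear_on_domZ linA); apply: (linear_on_domB linA).
apply/esym/euler_step_unique; rewrite ?ltW// -[in RHS]eJ (linear_onB linA)//.
  by rewrite (linear_onZ linA).
exact: (linear_on_domZ linA).
Qed.

Lemma euler_stepE h x : 0 <= h -> D x -> J h x - x = h%:C *: J h (A x).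
Proof.
move=> h0 Dx; rewrite -euler_step_comm_gen//.
move: h0; rewrite le_eqVlt => /predU1P[<-|h0].
  by rewrite euler_step_id subrr scale0r.
have [_ eJ] := euler_step_spec x h0.
by rewrite -{2}eJ opprB addrC subrK.
Qed.

Lemma euler_stepB h x y : J h (x - y) = J h x - J h y.
Proof.
by have := euler_step_linear h (-1) y x; rewrite !scaleN1r ![- _ + _]addrC.
Qed.

Lemma euler_stepD h x y : J h (x + y) = J h x + J h y.
Proof. by have := euler_step_linear h 1 x y; rewrite !scale1r. Qed.

Lemma euler_stepZ h a x : J h (a *: x) = a *: J h x.
Proof.
have J0 : J h 0 = 0 by rewrite -{1}(subrr 0) euler_stepB subrr.
by have := euler_step_linear h a x 0; rewrite J0 !addr0.
Qed.

Lemma euler_step_comm a b x : 0 <= a -> 0 <= b -> J a (J b x) = J b (J a x).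
Proof.
move=> a0; rewrite [0 <= b]le_eqVlt => /predU1P[<-|b0].
  by rewrite !euler_step_id.
have [Db eb] := euler_step_spec x b0.
apply/esym/euler_step_unique; [exact: ltW|exact: euler_step_dom|].
rewrite euler_step_comm_gen//.
by rewrite -euler_stepZ -euler_stepB eb.
Qed.

(** With P = A (J l x) and Q = A (J m x), one has x - J l x = - l P and x - J m x = - m Q, and the
    claim reduces to m ‖Q‖^2 <= l Re <P, Q>. *)
Lemma euler_step_mono l m x : 0 < m < l ->
  nrm (J m x - J l x) ^+ 2 <= nrm (x - J l x) ^+ 2 - nrm (x - J m x) ^+ 2.
Proof.
move=> /andP[m0 ml]; have l0 : 0 < l by exact: lt_trans ml.
have [Dm em] := euler_step_spec x m0; have [Dl el] := euler_step_spec x l0.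
set Q := A (J m x) in em; set P := A (J l x) in el.
have eq : J m x = x + m%:C *: Q by rewrite -[X in _ = X + _]em subrK.
have ep : J l x = x + l%:C *: P by rewrite -[X in _ = X + _]el subrK.
have := disA (linear_on_domB linA Dl Dm).
rewrite (linear_onB linA)// -/P -/Q.
have -> : J l x - J m x = l%:C *: P - m%:C *: Q.
  by rewrite eq ep opprD addrACA subrr add0r.
have -> : J m x - J l x = m%:C *: Q - l%:C *: P.
  by rewrite eq ep opprD addrACA subrr add0r.
have -> : x - J l x = - (l%:C *: P) by rewrite ep opprD addrA subrr add0r.
have -> : x - J m x = - (m%:C *: Q) by rewrite eq opprD addrA subrr add0r.
have := rip_ge0 ipP (l%:C *: P - m%:C *: Q).
rewrite !nrm_sqr// !ripE// (ripC ipP Q P).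
move: (rip ip P P) (rip ip P Q) (rip ip Q Q) => p c q h1 h2.
(* This product is ‖l P - m Q‖^2 minus l times the nonpositive number Re <P - Q, l P - m Q> given by
   dissipativity. *)
have : 0 <= (l - m) * (l * c - m * q) by nra.
rewrite pmulr_rge0 ?subr_gt0//; nra.
Qed.

(** This makes [D] dense, since J h x lies in it. Along h = 2^-n, [euler_step_mono] bounds squared
    distances by the increments of a monotone bounded sequence, so the steps converge; it remains to
    identify the limit. *)
Lemma euler_step_approx x e : 0 < e -> exists2 h, 0 < h & nrm (J h x - x) < e.
Proof.
pose h n : R := 2^-1 ^+ n.
have h0 n : 0 < h n by rewrite exprn_gt0 ?invr_gt0.
pose w n := nrm (x - J (h n) x) ^+ 2.
have hw m n : (m <= n)%N -> nrm (J (h n) x - J (h m) x) ^+ 2 <= w m - w n.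
  rewrite leq_eqVlt => /predU1P[->|mn].
    by rewrite /w !subrr nrm0// expr0n.
  apply: euler_step_mono; rewrite h0/= /h.
  by rewrite ltr_iXn2l// ?invr_gt0// invf_lt1// ltr1n.
have wni : nonincreasing_seq w.
  by move=> m n /hw; have := sqr_ge0 (nrm (J (h n) x - J (h m) x)); lra.
have wc : cvgn w.
  apply: nonincreasing_is_cvgn => //; exists 0 => _ [n _ <-]; exact: sqr_ge0.
have wL := nonincreasing_cvgn_ge wni wc.
have [l hl] : exists l, nrm (J (h n) x - l) @[n --> \oo] --> 0.
  apply: ipc => d d0.
  have /cvgrPdist_lt/(_ ((d / 2) ^+ 2)) := wc.
  case=> [|N _ /(_ N (leqnn N))]; first by rewrite exprn_gt0 ?divr_gt0.
  rewrite /= ler0_norm ?subr_le0// opprB => hN.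
  have hu n : (N <= n)%N -> nrm (J (h n) x - J (h N) x) < d / 2.
    move=> /hw hn.
    rewrite -(@ltr_pXn2r _ 2)// ?nnegrE ?nrm_ge0 ?divr_ge0 ?ltW//.
    by have := wL n; lra.
  exists N => m n /hu um /hu un.
  apply: le_lt_trans (nrm_dist ipP _ (J (h N) x) _) _.
  by rewrite [ltRHS]splitr ltrD// nrmC.
have hc : h n @[n --> \oo] --> 0 by apply: cvg_expr; rewrite ger0_norm//; lra.
(* [h n *: J (h n) x] tends to 0 and [A] maps it to [J (h n) x - x], which tends
   to [l - x]: as the graph of [A] is closed, [l - x = A 0]. *)
suff lx : l = x.
  move=> e0; rewrite lx in hl; have /cvgrPdist_lt/(_ e e0)[N _ hN] := hl.
  exists (h N) => //.
  by have := hN N (leqnn N); rewrite /= sub0r normrN ger0_norm ?nrm_ge0.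
(* The closed graph is used through [J 1], a nonexpansive inverse of 1 - A: it sends vectors tending
   to x - l to vectors tending to 0. *)
have J1 : J 1 (x - l) = 0.
  apply: (nrm_small_eq ipP) => d d0.
  have /cvgrPdist_lt/(_ (d / 2))[|N1 _ hN1] := hl; first by rewrite divr_gt0.
  have hx : h n * (nrm x *+ 2) @[n --> \oo] --> 0.
    by rewrite -[0](mul0r (nrm x *+ 2)); apply: cvgMl.
  have /cvgrPdist_lt/(_ (d / 2))[|N2 _ hN2] := hx; first by rewrite divr_gt0.
  pose n := maxn N1 N2.
  have := hN1 n (leq_maxl _ _).
  rewrite /= sub0r normrN ger0_norm ?nrm_ge0// => {}hN1.
  have := hN2 n (leq_maxr _ _); rewrite /= sub0r normrN ger0_norm; last first.
    by rewrite mulr_ge0 ?mulrn_wge0 ?nrm_ge0// ltW.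
  move=> {}hN2; have [Dn en] := euler_step_spec x (h0 n).
  set z := J (h n) x in Dn en hN1.
  (* Since A (h n z) = z - x, the argument is (1 - A) (h n z). *)
  have Jz : J 1 ((h n)%:C *: z - (z - x)) = (h n)%:C *: z.
    apply: euler_step_unique => //; first exact: (linear_on_domZ linA).
    rewrite scale1r (linear_onZ linA)//; congr (_ - _).
    by rewrite -[X in _ - X]en opprB addrC subrK.
  rewrite subr0 -[J 1 _](subrK ((h n)%:C *: z)) -{1}Jz -euler_stepB.
  have zx : nrm z <= nrm x by exact: euler_step_le.
  apply: le_trans (nrmD ipP _ _) _; rewrite nrmZr ?(ltW (h0 n))//.
  have := euler_step_le 1 (x - l - ((h n)%:C *: z - (z - x))).
  have -> : x - l - ((h n)%:C *: z - (z - x)) = (z - l) - (h n)%:C *: z.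
    by rewrite opprB addrA; congr (_ - _); rewrite addrC addrA subrK.
  have := nrmB ipP (z - l) ((h n)%:C *: z); rewrite nrmZr ?(ltW (h0 n))//.
  have : h n * nrm z <= h n * nrm x by rewrite ler_pM2l.
  by lra.
(* The equation defining [J 1 (x - l)] now reads 0 - A 0 = x - l. *)
have [_] := euler_step_spec (x - l) (@ltr01 R).
rewrite J1 (linear_on0 linA) scaler0 subrr => /esym/eqP.
by rewrite subr_eq0 => /eqP.
Qed.

End ImplicitEuler.

(** * The semigroup *)

Lemma cvg_at_right0P (R : realType) (f : R -> R) : (forall t, 0 <= f t) ->
  f t @[t --> 0^'+] --> 0 <->
  (forall e, 0 < e -> exists2 d, 0 < d & forall t, 0 < t -> t < d -> f t < e).
Proof.
move=> f0; split=> [/cvgrPdist_lt fc e e0|fe].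
  have [d /= d0 hd] := fc e e0; exists d => // t t0 td.
  have := hd t; rewrite /= !sub0r !normrN !ger0_norm//; last exact: ltW.
  by apply.
apply/cvgrPdist_lt => e /fe[d d0 hd]; exists d => // t.
rewrite /ball_ /= sub0r normrN => td t0; rewrite sub0r normrN ger0_norm//.
by apply: hd => //; rewrite -[t]gtr0_norm.
Qed.

Section SemigroupConstruction.
Variables (R : realType) (V : lmodType R[i]) (ip : V -> V -> R[i]).
Hypotheses (ipP : inner_product ip) (ipc : ip_complete ip).
Variables (D : set V) (A : V -> V).
Hypotheses (linA : linear_on D A).
Hypothesis disA : forall x, D x -> rip ip (A x) x <= 0.
Hypothesis ranA : forall l : R, 0 < l -> resolvent_at D A l%:C.

Local Notation nrm := (ipnorm ip).
Local Notation J := (euler_step D A).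

Let JB h x y : J h (x - y) = J h x - J h y.
Proof. exact: (euler_stepB ipP linA disA ranA). Qed.

Let JZ h a x : J h (a *: x) = a *: J h x.
Proof. exact: (euler_stepZ ipP linA disA ranA). Qed.

Let JD h x y : J h (x + y) = J h x + J h y.
Proof. exact: (euler_stepD ipP linA disA ranA). Qed.

Let JE h x : 0 <= h -> D x -> J h x - x = h%:C *: J h (A x).
Proof. exact: (euler_stepE ipP linA disA ranA). Qed.

Let JA h x : 0 <= h -> D x -> A (J h x) = J h (A x).
Proof. exact: (euler_step_comm_gen ipP linA disA ranA). Qed.

Let J_le h x : nrm (J h x) <= nrm x.
Proof. exact: (euler_step_le ipP disA ranA). Qed.

Let J_dist h x y : nrm (J h x - J h y) <= nrm (x - y).
Proof. by rewrite -JB J_le. Qed.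

Let J_comm a b x : 0 <= a -> 0 <= b -> J a (J b x) = J b (J a x).
Proof. exact: (euler_step_comm ipP linA disA ranA). Qed.

(* Membership in [D(A^2)], with a bound that every [J h] preserves. *)
Definition dom2 (K : R) : set V :=
  [set x | [/\ D x, D (A x) & nrm (A (A x)) <= K]].

Lemma dom2_step K h x : 0 <= h -> dom2 K x -> dom2 K (J h x).
Proof.
move=> h0 [Dx DAx AAx]; split; first exact: euler_step_dom.
  by rewrite JA//; apply: euler_step_dom.
by rewrite JA// JA//; apply: le_trans AAx.
Qed.

Lemma dom2_dense x e : 0 < e ->
  exists y, (exists K, dom2 K y) /\ nrm (x - y) < e.
Proof.
move=> e0; have e2 : 0 < e / 2 by rewrite divr_gt0.
have [h h0 hx] := euler_step_approx ipP ipc linA disA ranA x e2.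
have [DJ eJ] := euler_step_spec ranA x h0.
(* The first step lands in [D] and the second in the domain of A^2. As [J h] is nonexpansive, the
   second step moves the point no farther than the first. *)
exists (J h (J h x)); split.
  exists (nrm (A (A (J h (J h x))))); split=> //; first exact: euler_step_dom.
  rewrite JA ?ltW//; have [+ _] := euler_step_spec ranA (A (J h x)) h0; exact.
rewrite nrmC//; apply: le_lt_trans (nrm_dist ipP _ (J h x) _) _.
by rewrite [ltRHS]splitr ltrD//; apply: le_lt_trans hx; apply: J_dist.
Qed.

(** * Local errors of one step *)

Lemma step_near h x : 0 <= h -> D x -> nrm (J h x - x) <= h * nrm (A x).
Proof. by move=> h0 Dx; rewrite JE// nrmZr// ler_wpM2l. Qed.

(** The error is exactly (a + b) (J a (A x) - A x), and [step_near] applies to A x. Thus a step of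
    length a almost carries the Taylor polynomial at time b to the one at time a + b. *)
Lemma step_expand K a b x : 0 <= a -> 0 <= b -> dom2 K x ->
  nrm (J a (x + b%:C *: A x) - (x + (a + b)%:C *: A x)) <= (a * (a + b)) * K.
Proof.
move=> a0 b0 [Dx DAx AAx].
have -> : J a (x + b%:C *: A x) - (x + (a + b)%:C *: A x) =
    (a + b)%:C *: (J a (A x) - A x).
  have e : J a x = x + a%:C *: J a (A x) by rewrite -JE// subrKC.
  rewrite JD JZ e -[X in X - _]addrA -scalerDl -rmorphD.
  by rewrite opprD addrACA subrr add0r scalerBr.
rewrite nrmZr ?addr_ge0// -mulrA mulrCA ler_wpM2l ?addr_ge0//.
by apply: le_trans (step_near a0 DAx) _; rewrite ler_wpM2l.
Qed.

(** Both sides are compared with the Taylor polynomial x + (a + b) A x. *)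
Lemma step_split K a b x : 0 <= a -> 0 <= b -> dom2 K x ->
  nrm (J a (J b x) - J (a + b) x) <= 2 * (a + b) ^+ 2 * K.
Proof.
move=> a0 b0 Kx.
have K0 : 0 <= K by case: Kx => _ _; apply: le_trans (nrm_ge0 _ _).
have e1 := step_expand b0 (lexx 0) Kx.
have e2 := step_expand (addr_ge0 a0 b0) (lexx 0) Kx.
rewrite scale0r !addr0 in e1 e2.
have e3 := step_expand a0 b0 Kx.
have e4 := J_dist a (J b x) (x + b%:C *: A x).
have e5 := nrm_dist ipP (J a (J b x)) (J a (x + b%:C *: A x))
  (x + (a + b)%:C *: A x).
have e6 := nrm_dist ipP (J a (J b x)) (x + (a + b)%:C *: A x) (J (a + b) x).
rewrite (nrmC ipP (J (a + b) x)) in e2.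
(* The errors b^2 K, a (a + b) K and (a + b)^2 K add up to the claimed bound minus a b K. *)
have : 0 <= (a * b) * K by rewrite !mulr_ge0.
have : 0 <= a ^+ 2 * K by rewrite mulr_ge0 ?sqr_ge0.
have : 0 <= b ^+ 2 * K by rewrite mulr_ge0 ?sqr_ge0.
by nra.
Qed.

(** * Accumulation of local errors *)

Lemma iter_nonexpansive (P : V -> V) m x y :
  (forall x y, nrm (P x - P y) <= nrm (x - y)) ->
  nrm (iter m P x - iter m P y) <= nrm (x - y).
Proof.
move=> hP; elim: m => [//|m IH]; rewrite !iterS.
exact: le_trans (hP _ _) IH.
Qed.

(** Each step adds a local error at most [e], and the nonexpansive [P] does not amplify earlier
    ones. The orbit of [Q] stays in [S], where the local bound holds. *)
Lemma iter_dist (P Q : V -> V) (S : set V) (e : R) m x :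
  (forall x y, nrm (P x - P y) <= nrm (x - y)) ->
  (forall x, S x -> S (Q x)) -> (forall x, S x -> nrm (P x - Q x) <= e) ->
  S x -> nrm (iter m P x - iter m Q x) <= m%:R * e.
Proof.
move=> hP hQ hPQ Sx; have SQ k : S (iter k Q x) by elim: k => //= k /hQ.
elim: m => [|m IH]; first by rewrite subrr (nrm0 ipP) mul0r.
rewrite !iterS; apply: le_trans (nrm_dist ipP _ (P (iter m Q x)) _) _.
rewrite -addn1 natrD mulrDl mul1r lerD ?hPQ//.
exact: le_trans (hP _ _) IH.
Qed.

Lemma iter_step_near m h x : 0 <= h -> D x ->
  nrm (iter m (J h) x - x) <= m%:R * h * nrm (A x).
Proof.
move=> h0 Dx; rewrite -{2}(_ : iter m id x = x); last exact: iter_fix.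
(* The comparison map is the identity, whose orbit is the single point x. *)
rewrite -mulrA; apply: (@iter_dist (J h) id [set x]) => //.
by move=> _ ->; apply: step_near.
Qed.

Lemma iter_step_expand K m h x : 0 <= h -> dom2 K x ->
  nrm (iter m (J h) x - (x + (m%:R * h)%:C *: A x)) <= (m%:R * h) ^+ 2 * K.
Proof.
move=> h0 Kx.
have K0 : 0 <= K by case: Kx => _ _; apply: le_trans (nrm_ge0 _ _).
elim: m => [|m IH].
  by rewrite mul0r scale0r addr0 subrr (nrm0 ipP) expr0n mul0r.
have mh0 : 0 <= m%:R * h by rewrite mulr_ge0.
rewrite iterS.
apply: le_trans (nrm_dist ipP _ (J h (x + (m%:R * h)%:C *: A x)) _) _.
have := J_dist h (iter m (J h) x) (x + (m%:R * h)%:C *: A x).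
have := step_expand h0 mh0 Kx.
have -> : h + m%:R * h = m.+1%:R * h by rewrite -addn1 natrD; ring.
(* The slack in (m h)^2 + h (h + m h) <= ((m + 1) h)^2, times K. *)
have : 0 <= (m%:R * h) * h * K by rewrite !mulr_ge0.
rewrite -addn1 natrD; nra.
Qed.

(** * Dyadic Euler iterates and their limit *)

Definition dyadic_euler (n : nat) (t : R) : V -> V :=
  iter (2 ^ n) (J (t / (2 ^ n)%:R)).
Local Notation U := dyadic_euler.

Let dyadic_gt0 n : 0 < (2 ^ n)%:R :> R.
Proof. by rewrite ltr0n expn_gt0. Qed.

Let dyadicE n (t : R) : (2 ^ n)%:R * (t / (2 ^ n)%:R) = t.
Proof. by rewrite mulrC divfK// gt_eqF. Qed.

Let div_ge0 n (t : R) : 0 <= t -> 0 <= t / (2 ^ n)%:R.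
Proof. by move=> t0; rewrite divr_ge0. Qed.

Let half_expE n : (2 ^ n)%:R^-1 = 2^-1 ^+ n :> R.
Proof. by rewrite natrX exprVn. Qed.

Lemma dyadic_dist n t x y : nrm (U n t x - U n t y) <= nrm (x - y).
Proof. by apply: iter_nonexpansive => u v; apply: J_dist. Qed.

Lemma dyadic_linear n t : linear (U n t).
Proof.
move=> a x y; rewrite /U; move: (t / _) => h.
elim: (2 ^ n)%N => [//|m IH].
by rewrite !iterS IH JD JZ.
Qed.

Lemma dyadic_near n t x : 0 <= t -> D x -> nrm (U n t x - x) <= t * nrm (A x).
Proof.
move=> t0 Dx; rewrite -{2}(dyadicE n t).
by apply: iter_step_near; rewrite ?div_ge0.
Qed.

Lemma dyadic_expand K n t x : 0 <= t -> dom2 K x ->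
  nrm (U n t x - (x + t%:C *: A x)) <= t ^+ 2 * K.
Proof.
move=> t0 Kx; rewrite -{2 3}(dyadicE n t).
by apply: iter_step_expand; rewrite ?div_ge0.
Qed.

(** Steps commute, so they can be interleaved into 2^n pairs, each compared with one step of length
    a + b. The 2^n local errors of order (a + b)^2 leave a factor 2^-n. *)
Lemma dyadic_semigroup K n s t x : 0 <= s -> 0 <= t -> dom2 K x ->
  nrm (U n s (U n t x) - U n (s + t) x) <= 2 * (s + t) ^+ 2 * K * 2^-1 ^+ n.
Proof.
move=> s0 t0 Kx; pose a := s / (2 ^ n)%:R; pose b := t / (2 ^ n)%:R.
have a0 : 0 <= a by apply: div_ge0.
have b0 : 0 <= b by apply: div_ge0.
have ab k y : J a (iter k (J b) y) = iter k (J b) (J a y).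
  by elim: k => [//|k IH]; rewrite !iterS J_comm// IH.
have comm m : iter m (J a) (iter m (J b) x) = iter m (J a \o J b) x.
  elim: m x {Kx} => [//|m IH] x.
  by rewrite [LHS]iterSr [iter m.+1 (J b) x]iterSr ab [RHS]iterSr -IH.
rewrite /U comm mulrDl -/a -/b.
apply: le_trans
  (iter_dist (S := dom2 K) (e := 2 * (a + b) ^+ 2 * K) _ _ _ _ Kx) _.
- by move=> u v /=; apply: le_trans (J_dist _ _ _) (J_dist _ _ _).
- by move=> y; apply: dom2_step; apply: addr_ge0.
- by move=> y; apply: step_split.
- rewrite -half_expE /a /b -mulrDl exprMn expr2 le_eqVlt.
  apply/orP; left; apply/eqP; by field; rewrite gt_eqF.
Qed.

(** Each step of level n is compared with two half steps of level n + 1; again 2^n errors of order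
    4^-n accumulate. *)
Lemma dyadic_succ K n t x : 0 <= t -> dom2 K x ->
  nrm (U n.+1 t x - U n t x) <= 2 * t ^+ 2 * K * 2^-1 ^+ n.
Proof.
move=> t0 Kx; pose h := t / (2 ^ n.+1)%:R.
have h0 : 0 <= h by apply: div_ge0.
have hh : t / (2 ^ n)%:R = h + h.
  by rewrite /h expnS natrM; field; rewrite gt_eqF.
rewrite /U -/h hh expnSr iterM.
apply: le_trans
  (iter_dist (S := dom2 K) (e := 2 * (h + h) ^+ 2 * K) _ _ _ _ Kx) _.
- by move=> u v /=; apply: le_trans (J_dist _ _ _) (J_dist _ _ _).
- by move=> y; apply: dom2_step; apply: addr_ge0.
- by move=> y; apply: step_split.
- rewrite -hh -half_expE exprMn expr2 le_eqVlt; apply/orP; left; apply/eqP.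
  by field; rewrite gt_eqF.
Qed.

(** Geometric convergence on the dense set [dom2] extends to all x because the iterates are
    nonexpansive. *)
Lemma dyadic_cvg t x : 0 <= t -> exists l, nrm (U n t x - l) @[n --> \oo] --> 0.
Proof.
move=> t0; apply: ipc => e e0; have e3 : 0 < e / 3 by rewrite divr_gt0.
have [y [[K Ky] xy]] := dom2_dense x e3.
have q : 0 <= (2^-1 : R) < 1 by lra.
have [l hl] := geometric_cvg ipP ipc q (fun n => dyadic_succ n t0 Ky).
have e6 : 0 < e / 6 by rewrite divr_gt0.
have /cvgrPdist_lt/(_ _ e6)[N _ hN] := hl.
have {}hN n : (N <= n)%N -> nrm (U n t y - l) < e / 6.
  by move=> /hN /=; rewrite sub0r normrN ger0_norm ?nrm_ge0.
exists N => m n /hN um /hN un.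
have := nrm_dist ipP (U m t x) (U m t y) (U n t x).
have := nrm_dist ipP (U m t y) l (U n t x).
have := nrm_dist ipP l (U n t y) (U n t x).
have := dyadic_dist m t x y; have := dyadic_dist n t y x.
by rewrite (nrmC ipP y x) (nrmC ipP l (U n t y)); lra.
Qed.

(** For t >= 0 the set is a singleton by [dyadic_cvg] and [nrm_lim_unique]. *)
Definition semigroup_limit (t : R) (x : V) : V :=
  xget 0 [set l | nrm (U n t x - l) @[n --> \oo] --> 0].
Local Notation T := semigroup_limit.

Lemma semigroup_limit_cvg t x : 0 <= t ->
  nrm (U n t x - T t x) @[n --> \oo] --> 0.
Proof.
move=> /(dyadic_cvg x)[l hl]; rewrite /T; case: xgetP => [y _ //|/(_ l)].
by case.
Qed.
Local Notation T_cvg := semigroup_limit_cvg.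

Lemma semigroup_limit_linear t : 0 <= t -> linear (T t).
Proof.
move=> t0 a x y; apply: (nrm_lim_unique ipP (T_cvg _ t0)).
apply: (nrm_cvg_le (f := fun n => complex.Re `|a| * nrm (U n t x - T t x) +
  nrm (U n t y - T t y))).
  apply: nearW => n; rewrite dyadic_linear opprD addrACA -scalerBr.
  by rewrite -nrmZ// nrmD.
rewrite -[0]addr0; apply: cvgD; last exact: T_cvg.
by rewrite -[0](mulr0 (complex.Re `|a|)); apply: cvgMr; apply: T_cvg.
Qed.

Lemma semigroup_limitB t x y : 0 <= t -> T t (x - y) = T t x - T t y.
Proof.
move=> t0; have := semigroup_limit_linear t0 (-1) y x.
by rewrite !scaleN1r ![- _ + _]addrC.
Qed.

Lemma semigroup_limit_le t x : 0 <= t -> nrm (T t x) <= nrm x.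
Proof.
move=> t0; rewrite -[T t x]subr0; apply: (nrm_lim_le ipP (T_cvg _ t0)).
apply: nearW => n; have U0 : U n t 0 = 0.
  have := dyadic_linear n t (-1) 0 0.
  by rewrite scaler0 addr0 scaleN1r addrC subrr.
by have := dyadic_dist n t x 0; rewrite U0 !subr0.
Qed.

Lemma semigroup_limit0 x : T 0 x = x.
Proof.
apply: (nrm_lim_unique ipP (T_cvg x (lexx 0))).
apply: (nrm_cvg_le (f := fun=> 0)); last exact: cvg_cst.
(* At t = 0 every step has length 0, where [euler_step] is the identity by convention. *)
apply: nearW => n; rewrite /U mul0r iter_fix ?subrr ?(nrm0 ipP)//.
exact: euler_step_id.
Qed.

Lemma semigroup_limit_near t x : 0 <= t -> D x ->
  nrm (T t x - x) <= t * nrm (A x).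
Proof.
move=> t0 Dx; apply: (nrm_lim_le ipP (T_cvg _ t0)).
by apply: nearW => n; apply: dyadic_near.
Qed.

Lemma semigroup_limit_expand K t x : 0 <= t -> dom2 K x ->
  nrm (T t x - (x + t%:C *: A x)) <= t ^+ 2 * K.
Proof.
move=> t0 Kx; apply: (nrm_lim_le ipP (T_cvg _ t0)).
by apply: nearW => n; apply: dyadic_expand.
Qed.

(** The law passes to the limit from [dyadic_semigroup] on [dom2], then to all x by density, both
    sides being linear contractions. *)
Lemma semigroup_limitD s t x : 0 <= s -> 0 <= t -> T (s + t) x = T s (T t x).
Proof.
move=> s0 t0; have st0 := addr_ge0 s0 t0.
have h y K : dom2 K y -> T (s + t) y = T s (T t y).
  move=> Ky; apply: (nrm_lim_unique ipP (T_cvg _ st0)).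
  apply: (nrm_cvg_le (f := fun n => 2 * (s + t) ^+ 2 * K * 2^-1 ^+ n +
     (nrm (U n t y - T t y) + nrm (U n s (T t y) - T s (T t y))))).
    apply: nearW => n; apply: le_trans (nrm_dist ipP _ (U n s (U n t y)) _) _.
    rewrite lerD ?(nrmC ipP (U n (s + t) y)) ?dyadic_semigroup//.
    apply: le_trans (nrm_dist ipP _ (U n s (T t y)) _) _.
    by rewrite lerD ?dyadic_dist.
  rewrite -[0]addr0; apply: cvgD.
    rewrite -[0](mulr0 (2 * (s + t) ^+ 2 * K)); apply: cvgMr.
    by apply: cvg_expr; rewrite ger0_norm//; lra.
  by rewrite -[0]addr0; apply: cvgD; apply: T_cvg.
apply: (nrm_small_eq ipP) => e e0; have e2 : 0 < e / 2 by rewrite divr_gt0.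
have [y [[K Ky] xy]] := dom2_dense x e2.
have tri : nrm (T (s + t) x - T s (T t x)) <=
    nrm (T (s + t) (x - y)) + nrm (T s (T t (y - x))).
  rewrite (semigroup_limitB x y st0) (semigroup_limitB y x t0).
  rewrite (semigroup_limitB (T t y) (T t x) s0) -(h _ _ Ky).
  exact: nrm_dist.
apply: le_trans tri _; rewrite [leRHS]splitr; apply: lerD.
  exact: le_trans (semigroup_limit_le _ st0) (ltW xy).
apply: le_trans (semigroup_limit_le _ s0) _.
apply: le_trans (semigroup_limit_le _ t0) _.
by rewrite (nrmC ipP) ltW.
Qed.

(** * Strong continuity and the generator *)

Lemma semigroup_limit_continuous x :
  nrm (T t x - x) @[t --> 0^'+] --> 0.
Proof.
apply/cvg_at_right0P => [t|e e0]; first exact: nrm_ge0.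
have e3 : 0 < e / 3 by rewrite divr_gt0.
have [y [[K [Dy _ _]] xy]] := dom2_dense x e3.
have A0 := nrm_ge0 ip (A y).
(* The added 1 keeps the denominator positive when A y = 0. *)
exists (e / 3 / (nrm (A y) + 1)) => [|t t0]; first by rewrite !divr_gt0//; lra.
rewrite ltr_pdivlMr; last by lra.
move=> td; have t0' := ltW t0.
have := nrm_dist ipP (T t x) (T t y) x; have := nrm_dist ipP (T t y) y x.
rewrite -semigroup_limitB//; have := semigroup_limit_le (x - y) t0'.
have := semigroup_limit_near t0' Dy; rewrite (nrmC ipP y x); nra.
Qed.

(** Approximate x by y = J h x in the domain of A^2, for which A y = J h (A x) is close to A x. The
    second-order bound handles y, and the bound t ‖A (x - y)‖ handles the remainder. *)
Lemma semigroup_limit_derive x : D x ->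
  nrm ((t^-1)%:C *: (T t x - x) - A x) @[t --> 0^'+] --> 0.
Proof.
move=> Dx; apply/cvg_at_right0P => [t|e e0]; first exact: nrm_ge0.
have e3 : 0 < e / 3 by rewrite divr_gt0.
have [h h0 hA] := euler_step_approx ipP ipc linA disA ranA (A x) e3.
pose y := J h x; have [DJ eJ] := euler_step_spec ranA x h0.
have Ay : A y = J h (A x) by rewrite /y JA ?ltW.
pose K := nrm (A (A y)).
have Ky : dom2 K y.
  split=> //; rewrite Ay.
  by have [] := euler_step_spec ranA (A x) h0.
have K0 : 0 <= K by apply: nrm_ge0.
exists (e / 3 / (K + 1)) => [|t t0]; first by rewrite !divr_gt0//; lra.
rewrite ltr_pdivlMr; last by lra.
move=> td; have t0' := ltW t0.
have -> : (t^-1)%:C *: (T t x - x) - A x =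
    (t^-1)%:C *: (T t x - (x + t%:C *: A x)).
  rewrite [in RHS]opprD addrA [in RHS]scalerBr scalerA -rmorphM/=.
  by rewrite mulVf ?gt_eqF// scale1r.
rewrite nrmZr ?invr_ge0// ltr_pdivrMl//.
have e1 : x - y + t%:C *: (A x - A y) = x + t%:C *: A x - (y + t%:C *: A y).
  by rewrite scalerBr opprD addrACA.
(* The first-order remainder is linear in the vector, so it splits into those of x - y and of y. *)
have e2 : T t (x - y) - (x - y) - t%:C *: (A x - A y) =
    (T t x - (x + t%:C *: A x)) - (T t y - (y + t%:C *: A y)).
  by rewrite -[LHS]addrA -opprD e1 semigroup_limitB// subrACA.
rewrite -[T t x - _](subrK (T t y - (y + t%:C *: A y))) -e2.
have Dxy := linear_on_domB linA Dx DJ.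
apply: le_lt_trans (nrmD ipP _ _) _.
have := semigroup_limit_expand t0' Ky.
have := nrmB ipP (T t (x - y) - (x - y)) (t%:C *: (A x - A y)).
have := semigroup_limit_near t0' Dxy.
rewrite (linear_onB linA)// nrmZr// (nrmC ipP (A x)) Ay.
have : t * (t * (K + 1)) < t * (e / 3) by rewrite ltr_pM2l.
have : t * nrm (J h (A x) - A x) < t * (e / 3) by rewrite ltr_pM2l.
have : 0 < t * t by rewrite mulr_gt0.
by rewrite expr2; lra.
Qed.

(** Contractivity gives Re <T t x - x, x> <= ‖T t x‖ ‖x‖ - ‖x‖^2 <= 0. Here x ranges over all points
    with a right derivative at 0, as needed to show that they lie in [D]. *)
Lemma semigroup_derivative_dissipative x y :
  nrm ((t^-1)%:C *: (T t x - x) - y) @[t --> 0^'+] --> 0 -> rip ip y x <= 0.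
Proof.
move=> hxy; apply/ler_addgt0Pr => e e0; rewrite add0r.
have nx : 0 < nrm x + 1 by have := nrm_ge0 ip x; lra.
have [d d0 hd] :=
  (cvg_at_right0P (fun=> nrm_ge0 ip _)).1 hxy _ (divr_gt0 e0 nx).
have := hd (d / 2); rewrite divr_gt0//; set t := d / 2 => /(_ isT).
have t0 : 0 < t by rewrite divr_gt0.
have td : t < d by rewrite /t; lra.
move=> /(_ td); rewrite (nrmC ipP) ltr_pdivlMr// => ht.
have := rip_le ipP (y - (t^-1)%:C *: (T t x - x)) x.
have : rip ip (T t x - x) x <= 0.
  rewrite !ripE// subr_le0; apply: le_trans (rip_le ipP _ _) _.
  by rewrite -nrm_sqr// expr2 ler_wpM2r ?nrm_ge0// semigroup_limit_le// ltW.
move=> hT; have : t^-1 * rip ip (T t x - x) x <= 0.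
  by rewrite pmulr_rle0 ?invr_gt0.
rewrite (ripDl ipP y) (ripNl ipP (_ *: _)) ripZl//.
by have := nrm_ge0 ip (y - (t^-1)%:C *: (T t x - x)); lra.
Qed.

(** Maximality: if x has derivative y, solve z - A z = x - y in [D]. Then x - z has derivative y - A
    z = x - z, and dissipativity forces ‖x - z‖^2 <= 0. *)
Lemma semigroup_generator x y :
  nrm ((t^-1)%:C *: (T t x - x) - y) @[t --> 0^'+] --> 0 <-> (D x /\ A x = y).
Proof.
split=> [hxy|[Dx <-]]; last exact: semigroup_limit_derive.
have [z Dz] := ranA ltr01 (x - y); rewrite scale1r => ez.
suff xz : x = z by split; rewrite xz//; move/eqP: ez; rewrite xz => /eqP/subrI.
apply/eqP; rewrite -subr_eq0; apply/eqP/(rip_eq0 ipP)/eqP.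
rewrite eq_le rip_ge0// andbT.
have exz : x - z = y - A z.
  by rewrite -[x](subrK y) -ez addrAC [z - _ - z]addrAC subrr sub0r addrC.
rewrite [X in rip ip X _]exz.
have hz := semigroup_limit_derive Dz.
apply: semigroup_derivative_dissipative.
apply: (squeeze_cvgr (f := fun=> 0) (h := fun t =>
    nrm ((t^-1)%:C *: (T t x - x) - y) + nrm ((t^-1)%:C *: (T t z - z) - A z))).
- near=> t; rewrite nrm_ge0/= semigroup_limitB; last first.
    by near: t; apply: nbhs_right_ge.
  by rewrite subrACA scalerBr subrACA nrmB.
- exact: cvg_cst.
- by have := cvgD hxy hz; rewrite addr0; apply.
Unshelve. all: by end_near. Qed.

Lemma semigroup_limit_contraction :
  contraction_semigroup [set: V] ip T.
Proof.
split=> [t t0 //|t t0|x _|s t x s0 t0 _|x _|t x t0 _].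
- by split=> // a x y _ _; apply: semigroup_limit_linear.
- exact: semigroup_limit0.
- exact: semigroup_limitD.
- exact: semigroup_limit_continuous.
- exact: semigroup_limit_le.
Qed.

End SemigroupConstruction.

(** * The Lumer-Phillips theorem *)

Theorem lumer_phillips (R : realType) (V : lmodType R[i]) (ip : V -> V -> R[i])
    (D : set V) (A : V -> V) (s : R[i]) :
  inner_product ip -> ip_complete ip -> linear_on D A ->
  (forall x, D x -> rip ip (A x) x <= 0) ->
  0 < complex.Re s -> resolvent_at D A s ->
  generates_contraction_semigroup [set: V] ip D A.
Proof.
move=> ipP ipc linA disA s0 rs.
have ranA l : 0 < l -> resolvent_at D A l%:C.
  by move=> l0; apply: (resolvent_at_real ipP ipc linA disA s0 l0 rs).
exists (semigroup_limit ip D A); first exact: semigroup_limit_contraction.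
by split=> // x y _ _; apply: semigroup_generator.
Qed.

(** * Closed subspaces *)

Section Subspace.
Variables (R : realType) (V : lmodType R[i]) (S : set V).
(** With the identity as operator, [linear_on] says that [S] is a linear subspace. *)
Hypothesis clS : linear_on S (@id V).

(* The unused [clS] lets the module structure, which depends on it, be found from
   the type alone. *)
Definition subspace : Type := let _ := clS in {x : V | x \in S}.

HB.instance Definition _ := SubChoice.copy subspace {x : V | x \in S}.

Let subspace_closed : GRing.subsemimod_closed [in S].
Proof.
split; first split=> [|x y /set_mem Sx /set_mem Sy]; first apply/mem_set.
- exact: linear_on_dom0 clS.
- by apply/mem_set; apply: (linear_on_domD clS).
- by move=> a x /set_mem Sx; apply/mem_set; apply: (linear_on_domZ clS).
Qed.

HB.instance Definition _ :=
  GRing.SubChoice_isSubLmodule.Build R[i] V [in S] subspace subspace_closed.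

(** Points outside [S] are sent to 0; on [S] it inverts [val]. *)
Definition to_subspace (x : V) : subspace := insubd 0 x.
Local Notation L := to_subspace.

Lemma to_subspaceK x : S x -> val (L x) = x.
Proof. by move=> Sx; rewrite /L insubdK//; apply/mem_set. Qed.

Lemma val_subspaceK : cancel val L.
Proof. by move=> x; rewrite /L valKd. Qed.

Lemma subspaceP (x : subspace) : S (val x).
Proof. exact: set_mem (valP x). Qed.

End Subspace.

(** Everything is transported to the subtype of points of [S], where the operator acts on a whole
    space; the semigroup comes back as [val] after [T t] after [L]. *)
Theorem lumer_phillips_subspace (R : realType) (V : lmodType R[i]) (S : set V)
    (ip : V -> V -> R[i]) (D : set V) (A : V -> V) (s : R[i]) :
  linear_on S (@id V) -> inner_product ip ->
  (forall u : nat -> V, (forall n, S (u n)) ->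
    (forall e : R, 0 < e -> exists N, forall m n, (N <= m)%N -> (N <= n)%N ->
      ipnorm ip (u m - u n) < e) ->
    exists2 l, S l & ipnorm ip (u n - l) @[n --> \oo] --> 0) ->
  D `<=` S -> set_fun D S A -> linear_on D A ->
  (forall x, D x -> rip ip (A x) x <= 0) -> 0 < complex.Re s ->
  (forall f, S f -> exists2 x, D x & s *: x - A x = f) ->
  generates_contraction_semigroup S ip D A.
Proof.
move=> clS ipP ipc DS AS linA disA s0 ranA.
pose W := subspace clS; pose L : V -> W := to_subspace clS.
pose ip' (x y : W) := ip (val x) (val y).
pose D' : set W := [set x | D (val x)]; pose A' (x : W) := L (A (val x)).
have LK x : S x -> val (L x) = x by apply: to_subspaceK.
have A'E x : D' x -> val (A' x) = A (val x).
  by move=> Dx; rewrite to_subspaceK//; apply: AS.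
have LD x : D x -> D' (L x).
  by move=> Dx; rewrite /D' /= to_subspaceK//; apply: DS.
have clW : [/\ inner_product ip', ip_complete ip', linear_on D' A' &
    forall x, D' x -> rip ip' (A' x) x <= 0].
  split.
  - split=> [a x y z|x y|x|x x0]; first exact: (ip_linear ipP).
    + exact: (ip_conj ipP).
    + exact: (ip_ge0 ipP).
    + by apply/val_inj/(ip_eq0 ipP).
  - move=> u uc; have [|l Sl ul] := ipc (val \o u) _ uc.
      by move=> n; apply: subspaceP.
    by exists (L l); rewrite /ipnorm /ip' /= to_subspaceK.
  - split=> [|a x y Dx Dy|a x y Dx Dy].
    + exact: linear_on_dom0 linA.
    + apply: (linear_on_domD linA) => //; exact: (linear_on_domZ linA).
    + apply: val_inj; rewrite /= [LHS]A'E ?A'E//; last first.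
        apply: (linear_on_domD linA) => //; exact: (linear_on_domZ linA).
      by case: linA => _ _; apply.
  - by move=> x Dx; rewrite /rip /ip' A'E//; apply: disA.
have [ipP' ipc' linA' disA'] := clW.
have ranA' : resolvent_at D' A' s.
  move=> f; have [x Dx e] := ranA (val f) (subspaceP f).
  exists (L x); first exact: LD.
  apply: val_inj; rewrite /= A'E; last exact: LD.
  by move: e; rewrite -{1 2}(LK x (DS _ Dx)).
have [T Tc Tg] := lumer_phillips ipP' ipc' linA' disA' s0 ranA'.
have LL a x y : S x -> S y -> L (a *: x + y) = a *: L x + L y.
  move=> Sx Sy; apply: val_inj; rewrite /= !LK//.
  by apply: (linear_on_domD clS) => //; apply: (linear_on_domZ clS).
exists (fun t x => val (T t (L x))).
  split.
  - by move=> t t0 x Sx; apply: subspaceP.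
  - move=> t t0; split=> [|a x y Sx Sy|a x y Sx Sy].
    + exact: linear_on_dom0 clS.
    + apply: (linear_on_domD clS) => //; exact: (linear_on_domZ clS).
    + rewrite LL//; case: (semigroup_linear Tc t0) => _ _ h.
      by rewrite h.
  - by move=> x Sx; rewrite (semigroup0 Tc)// LK.
  - by move=> a b x a0 b0 Sx; rewrite (semigroupD Tc)// [in RHS]/L val_subspaceK.
  - by move=> x Sx; have := semigroup_cvg Tc (x := L x) I;
      rewrite /ipnorm /ip' /= LK.
  - move=> t x t0 Sx; have := semigroup_contraction Tc (x := L x) t0 I.
    by rewrite /ipnorm /ip' /= LK.
split=> // x y Sx Sy.
have [_ _ /(_ (L x) (L y) I I)] := Tg.
rewrite {1}/ipnorm /ip' /= !LK// => ->; rewrite /D' /= LK//.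
split=> -[Dx e]; split=> //; last by rewrite /A' LK// e.
by move: e => /(congr1 val); rewrite /A' !LK//; apply: AS.
Qed.

(** * The reduced operator *)

Lemma closure_normP (K : numFieldType) (V : normedModType K) (W : set V) x :
  closure W x <-> forall e : K, 0 < e -> exists2 w, W w & `|x - w| < e.
Proof.
split=> [cx e e0|h B /nbhs_ballP[e /= e0 eB]].
  have [w [Ww xw]] := cx _ (nbhsx_ballx x _ e0).
  by exists w => //; move: xw; rewrite -ball_normE.
have [w Ww xw] := h e e0; exists w; split=> //.
by apply: eB; rewrite -ball_normE.
Qed.

Lemma linear_on_closure (R : realType) (V : normedModType R[i]) (W : set V) :
  linear_on W (@id V) -> linear_on (closure W) (@id V).
Proof.
move=> linW; split=> // [|a x y /closure_normP Wx /closure_normP Wy].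
  by apply: subset_closure; apply: linear_on_dom0 linW.
apply/closure_normP => e e0.
have a0 : 0 < `|a| + 1 by rewrite ltr_wpDl.
(* The tolerance is divided by |a| + 1 to absorb the factor |a|, which may be 0. *)
have [|u Wu xu] := Wx (e / 2 / (`|a| + 1)); first by rewrite !divr_gt0.
have [|v Wv yv] := Wy (e / 2); first by rewrite divr_gt0.
exists (a *: u + v).
  by apply: (linear_on_domD linW) => //; apply: (linear_on_domZ linW).
rewrite opprD addrACA -scalerBr; apply: le_lt_trans (ler_normD _ _) _.
rewrite (splitr e) ler_ltD// normrZ.
rewrite ltr_pdivlMr// in xu; apply: le_trans (ltW xu).
by rewrite mulrC ler_wpM2l// lerDl.
Qed.

Lemma normcR (R : realType) (V : normedModType R[i]) (x : V) :
  `|x| = (complex.Re `|x|)%:C.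
Proof. by rewrite RRe_real// ger0_real. Qed.

Lemma sqr_norm_le0 (R : realType) (V : normedModType R[i]) (k : R) (x : V) :
  0 < k -> k%:C * `|x| ^+ 2 <= 0 -> x = 0.
Proof.
move=> k0; rewrite pmulr_rle0 ?ltcR// => h; apply/eqP.
by rewrite -normr_eq0 -sqrf_eq0 eq_le h exprn_ge0.
Qed.

Lemma bounded_op_ge0 (R : realType) (V W : normedModType R[i]) (T : V -> W) :
  bounded_op T -> exists2 M : R, 0 <= M & forall x, `|T x| <= M%:C * `|x|.
Proof.
move=> [M hM]; exists `|M| => // x; apply: le_trans (hM x) _.
by rewrite ler_wpM2r// lecR ler_norm.
Qed.

Lemma set_bij_pinvK (T U : Type) (dflt : U -> T) (f : T -> U) :
  set_bij [set: T] [set: U] f ->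
  cancel ('pinv_dflt [set: T] f) f /\ cancel f ('pinv_dflt [set: T] f).
Proof.
move=> [_ finj fsurj]; split=> x.
  by apply: (surjpK _ fsurj); rewrite in_setT.
by apply: pinvKV; rewrite ?in_setT.
Qed.

(** * The inner product of a Hilbert space *)

Section Hdot.
Variables (R : realType) (H : hilbertType R).

Lemma hdot_linear a (x y z : H) :
  hdot (a *: x + y) z = a * hdot x z + hdot y z.
Proof. by rewrite /hdot linearPl. Qed.

Lemma hdot_conj (x y : H) : hdot y x = (hdot x y)^*.
Proof. exact: dot_conj. Qed.

Lemma hdot0r (x : H) : hdot x 0 = 0.
Proof. by rewrite /hdot linear0r. Qed.

Lemma hdot0l (x : H) : hdot 0 x = 0.
Proof. by rewrite /hdot linear0l. Qed.

Lemma hdot_le (x y : H) : `|hdot x y| <= `|x| * `|y|.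
Proof.
have := dot_cauchy_schwarz (@hform R H) x y.
by rewrite -!/(hdot _ _) !hdotE !sqrCK.
Qed.

End Hdot.

Lemma hdot_pair (R : realType) (X1 X2 : hilbertType R) (a b : X1) (c d : X2) :
  hdot ((a, c) : X1 \oplus X2) ((b, d) : X1 \oplus X2) = hdot a b + hdot c d.
Proof. by []. Qed.

(** * The energy inner product and the equivalence of norms *)

Section EnergyProduct.
Variables (R : realType) (X : hilbertType R) (E Q : {linear X -> X}).
Hypotheses (bE : bounded_op E) (bQ : bounded_op Q).
Hypothesis coEQ : coercive (adjoint E \o Q).

(* If the Riesz representative defining the adjoint did not exist, [adjoint]
   would return 0, which coercivity only allows at [y = 0]. *)
Lemma coercive_adjointE x y : hdot x (adjoint E (Q y)) = hdot (E x) (Q y).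
Proof.
have [_ [k k0 hk]] := coEQ; have := hk y; rewrite /= /adjoint.
case: xgetP => [z _ -> //|noz].
rewrite hdot0l => /(sqr_norm_le0 k0) y0.
by case: (noz 0) => u; rewrite y0 linear0 !hdot0r.
Qed.

Local Notation ip := (fun x y : X => hdot x (adjoint E (Q y))).

(** Hermitian symmetry is the self-adjointness contained in coercivity; positivity and definiteness
    come from its lower bound. *)
Lemma energy_product : inner_product ip.
Proof.
have [sa [k k0 hk]] := coEQ.
have ge x : k%:C * `|x| ^+ 2 <= hdot x (adjoint E (Q x)).
  by rewrite -[X in _ <= X]sa; apply: hk.
split=> [a x y z|x y|x|x x0].
- exact: hdot_linear.
- by rewrite hdot_conj; congr (_ ^*)%C; exact: sa.
- by apply: le_trans (ge x); rewrite mulr_ge0 ?exprn_ge0// ler0c ltW.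
- by have := ge x; rewrite x0 => /(sqr_norm_le0 k0).
Qed.

(** The constant is the square root of the coercivity constant. *)
Lemma energy_norm_ge : exists2 c : R, 0 < c &
  forall x, c * complex.Re `|x| <= ipnorm ip x.
Proof.
have [sa [k k0 hk]] := coEQ; exists (Num.sqrt k); first by rewrite sqrtr_gt0.
move=> x; have nx0 : 0 <= complex.Re `|x| by rewrite -ler0c -normcR.
rewrite -(@ler_pXn2r _ 2)// ?nnegrE ?nrm_ge0// ?mulr_ge0 ?sqrtr_ge0//.
rewrite (nrm_sqr energy_product) exprMn sqr_sqrtr ?(ltW k0)//.
have := hk x; rewrite sa /= normcR -rmorphXn -rmorphM lecE /=.
by case/andP.
Qed.

(** Cauchy-Schwarz on <E x, Q x> with bounds M for E and N for Q gives the constant sqrt (M N). *)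
Lemma energy_norm_le : exists2 C : R, 0 <= C &
  forall x, ipnorm ip x <= C * complex.Re `|x|.
Proof.
have [M M0 hM] := bounded_op_ge0 bE; have [N N0 hN] := bounded_op_ge0 bQ.
exists (Num.sqrt (M * N)); first exact: sqrtr_ge0.
move=> x; have nx0 : 0 <= complex.Re `|x| by rewrite -ler0c -normcR.
rewrite -(@ler_pXn2r _ 2)// ?nnegrE ?nrm_ge0// ?mulr_ge0 ?sqrtr_ge0//.
rewrite (nrm_sqr energy_product) exprMn sqr_sqrtr ?mulr_ge0//.
have : `|ip x x| <= (M * N * complex.Re `|x| ^+ 2)%:C.
  rewrite coercive_adjointE; apply: le_trans (hdot_le _ _) _.
  rewrite expr2 !rmorphM /= -!normcR mulrACA.
  exact: ler_pM.
rewrite normc_def lecR; apply: le_trans.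
apply: le_trans (ler_norm _) _; rewrite -sqrtr_sqr ler_wsqrtr// lerDl.
exact: sqr_ge0.
Qed.

(** The lower norm bound makes the sequence Cauchy in [X]; the upper one turns its limit there into
    a limit in the energy norm. *)
Lemma energy_complete (S : set X) (u : nat -> X) : closed S ->
  (forall n, S (u n)) ->
  (forall e : R, 0 < e -> exists N, forall m n, (N <= m)%N -> (N <= n)%N ->
    ipnorm ip (u m - u n) < e) ->
  exists2 l, S l & ipnorm ip (u n - l) @[n --> \oo] --> 0.
Proof.
move=> cS Su uc; have [c c0 hc] := energy_norm_ge.
have [C C0 hC] := energy_norm_le.
have : cvg (u @ \oo).
  apply: cauchy_cvg; apply/cauchyP => e e0.
  have [er re0] : e = (complex.Re e)%:C /\ 0 < complex.Re e.
    by rewrite -ltcR RRe_real// ger0_real// ltW.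
  have [N hN] := uc _ (mulr_gt0 c0 re0).
  exists (u N); exists N => // n /= Nn; rewrite -ball_normE /=.
  rewrite normcR er ltcR -(ltr_pM2l c0).
  exact: le_lt_trans (hc _) (hN _ _ _ _).
move=> /cvg_ex[l ul]; exists l.
  by apply: (closed_cvg _ cS _ _ ul); apply: nearW.
have C1 : 0 < C + 1 by rewrite ltr_wpDl.
apply/cvgrPdist_lt => e e0.
have /cvgrPdist_lt/(_ (e / (C + 1))%:C) := ul.
rewrite ltcR divr_gt0// => /(_ isT); apply: filterS => n.
rewrite distrC normcR ltcR ltr_pdivlMr// => ule.
rewrite sub0r normrN ger0_norm ?nrm_ge0//; apply: le_lt_trans (hC _) _.
apply: le_lt_trans ule; rewrite mulrC ler_wpM2l ?lerDl//.
by rewrite -ler0c -normcR.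
Qed.

End EnergyProduct.

(** * Single-valuedness, dissipativity and range of the reduced operator *)

Theorem theorem33 (R : realType) (X1 X2 : hilbertType R)
    (DA : set (X1 \oplus X2))
    (A1 : X1 \oplus X2 -> X1) (A2 : X1 \oplus X2 -> X2)
    (E1 Q1 : {linear X1 -> X1}) (Q2 : {linear X2 -> X2}) :
  let A : X1 \oplus X2 -> X1 \oplus X2 := fun x => (A1 x, A2 x) in
  let E : X1 \oplus X2 -> X1 \oplus X2 := diag_op E1 (fun=> 0) in
  let Q : X1 \oplus X2 -> X1 \oplus X2 := diag_op Q1 Q2 in
  let E1inv : X1 -> X1 := 'pinv_(fun=> 0) [set: X1] E1 in
  let W0 : set X1 :=
    [set x1 | exists x2 : X2, DA (Q1 x1, Q2 x2) /\ A2 (Q1 x1, Q2 x2) = 0] in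
  let X0 : set X1 := closure W0 in
  let ipEQ : X1 -> X1 -> R[i] := fun x y => hdot x (adjoint E1 (Q1 y)) in
  let red_at : X1 -> X2 -> Prop := fun x1 x2 =>
    [/\ DA (Q1 x1, Q2 x2), A2 (Q1 x1, Q2 x2) = 0 &
        X0 (E1inv (A1 (Q1 x1, Q2 x2)))] in
  let Dred : set X1 := [set x1 | X0 x1 /\ exists x2 : X2, red_at x1 x2] in
  linear_on DA A ->
  dissipative DA A ->
  bounded_op E1 -> boundedly_invertible [set: X1] E1 ->
  bounded_op Q1 -> boundedly_invertible [set: X1] Q1 ->
  bounded_op Q2 -> boundedly_invertible [set: X2] Q2 ->
  coercive (adjoint E1 \o Q1) ->
  regular_pair E (Q @^-1` DA) (A \o Q) ->
  [set y1 | X0 y1 /\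
     exists x2 : X2, DA (0, Q2 x2) /\ A (0, Q2 x2) = (E1 y1, 0)] = [set 0] ->
  exists2 Ared : X1 -> X1,
    forall x1 x2, X0 x1 -> red_at x1 x2 ->
      Ared x1 = E1inv (A1 (Q1 x1, Q2 x2)) &
    generates_contraction_semigroup X0 ipEQ Dred Ared.
Proof.
move=> A E Q E1inv W0 X0 ipEQ red_at Dred linA disA bE [bijE _] bQ _ _ _ coEQ.
move=> [s s0 [[_ _ surj] _]] ker0.
have [E1K E1K'] : cancel E1inv E1 /\ cancel E1 E1inv by apply: set_bij_pinvK.
have ipE x y : ipEQ x y = hdot (E1 x) (Q1 y) by apply: coercive_adjointE.
have QE a x1 x2 y1 y2 : (Q1 (a *: x1 + y1), Q2 (a *: x2 + y2)) =
    a *: ((Q1 x1, Q2 x2) : X1 \oplus X2) + ((Q1 y1, Q2 y2) : X1 \oplus X2).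
  by rewrite !linearP.
have DAlin a u v : DA u -> DA v -> DA (a *: u + v).
  by move=> Du Dv; case: linA => _ + _; apply.
have A1lin a u v : DA u -> DA v -> A1 (a *: u + v) = a *: A1 u + A1 v.
  by move=> Du Dv; case: linA => _ _ /(_ a u v Du Dv) /(congr1 fst).
have A2lin a u v : DA u -> DA v -> A2 (a *: u + v) = a *: A2 u + A2 v.
  by move=> Du Dv; case: linA => _ _ /(_ a u v Du Dv) /(congr1 snd).
have linE1inv a x y : E1inv (a *: x + y) = a *: E1inv x + E1inv y.
  by apply: (can_inj E1K'); rewrite linearP !E1K.
have linW0 : linear_on W0 (@id X1).
  split=> // [|a x y [x2 [Dx Ax]] [y2 [Dy Ay]]].
    exists 0; have z : ((Q1 0, Q2 0) : X1 \oplus X2) = 0 by rewrite !linear0.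
    rewrite z; split; first exact: linear_on_dom0 linA.
    by have /(congr1 snd) := linear_on0 linA.
  exists (a *: x2 + y2); rewrite QE A2lin// Ax Ay scaler0 addr0.
  by split=> //; apply: DAlin.
have linX0 : linear_on X0 (@id X1) by apply: linear_on_closure.
have red_lin a x1 x2 y1 y2 : red_at x1 x2 -> red_at y1 y2 ->
    red_at (a *: x1 + y1) (a *: x2 + y2) /\
    E1inv (A1 (Q1 (a *: x1 + y1), Q2 (a *: x2 + y2))) =
    a *: E1inv (A1 (Q1 x1, Q2 x2)) + E1inv (A1 (Q1 y1, Q2 y2)).
  move=> [Dx Ax Xx] [Dy Ay Xy].
  have e : E1inv (A1 (Q1 (a *: x1 + y1), Q2 (a *: x2 + y2))) =
      a *: E1inv (A1 (Q1 x1, Q2 x2)) + E1inv (A1 (Q1 y1, Q2 y2)).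
    by rewrite QE A1lin// linE1inv.
  split=> //; split; rewrite ?e.
  - by rewrite QE; apply: DAlin.
  - by rewrite QE A2lin// Ax Ay scaler0 addr0.
  - by apply: (linear_on_domD linX0) => //; apply: (linear_on_domZ linX0).
(* The difference of two candidates has first component 0, so the difference of their values lies in
   the set that the kernel condition reduces to 0. *)
have red_uniq x1 x2 y2 : red_at x1 x2 -> red_at x1 y2 ->
    E1inv (A1 (Q1 x1, Q2 x2)) = E1inv (A1 (Q1 x1, Q2 y2)).
  move=> rx ry; have [[D0 A20 X00] e] := red_lin (-1) _ _ _ _ rx ry.
  rewrite scaleN1r addNr linear0 in D0 A20 X00 e.
  set v := E1inv (A1 (0, _)) in X00 e.
  have : [set y1 | X0 y1 /\ exists x2 : X2,
      DA (0, Q2 x2) /\ A (0, Q2 x2) = (E1 y1, 0)] v.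
    split=> //; exists (-1 *: x2 + y2); split=> //.
    by rewrite /A A20 /v E1K.
  rewrite ker0 /= => v0; apply/eqP; rewrite -subr_eq0 -oppr_eq0 opprB.
  by rewrite addrC -scaleN1r -e v0.
(* Any admissible second component serves, by [red_uniq]; the default 0 only occurs when there is
   none. *)
pose pick x1 : X2 := xget 0 [set x2 | red_at x1 x2].
pose Ared x1 := E1inv (A1 (Q1 x1, Q2 (pick x1))).
have AredE x1 x2 : red_at x1 x2 -> Ared x1 = E1inv (A1 (Q1 x1, Q2 x2)).
  by move=> r; apply: red_uniq => //; apply: (xgetI _ r).
exists Ared; first by move=> x1 x2 _; apply: AredE.
apply: (@lumer_phillips_subspace _ _ _ _ _ _ s) => //.
- exact: energy_product.
- move=> u Su uc; apply: energy_complete => //; exact: closed_closure.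
- by move=> x [].
- by move=> x [_ [x2 r]]; rewrite (AredE _ _ r); case: r.
- split=> [|a x y [Xx [x2 rx]] [Xy [y2 ry]]|a x y [Xx [x2 rx]] [Xy [y2 ry]]].
  + split; first exact: linear_on_dom0 linX0.
    exists 0; have z : ((Q1 0, Q2 0) : X1 \oplus X2) = 0 by rewrite !linear0.
    have /(congr1 fst) /= A10 := linear_on0 linA.
    have /(congr1 snd) /= A20 := linear_on0 linA.
    split; rewrite z//; first exact: linear_on_dom0 linA.
    rewrite A10; have /(congr1 E1inv) := linear0 E1; rewrite E1K' => <-.
    exact: linear_on_dom0 linX0.
  + split; last by exists (a *: x2 + y2); case: (red_lin a _ _ _ _ rx ry).
    by apply: (linear_on_domD linX0) => //; apply: (linear_on_domZ linX0).
  + have [r e] := red_lin a _ _ _ _ rx ry.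
    by rewrite (AredE _ _ r) e (AredE _ _ rx) (AredE _ _ ry).
(* Here [E1] cancels [E1inv], leaving <A1 z, Q1 x> with z = (Q1 x, Q2 x2). As A2 z = 0, this is <A
   z, z>. *)
- move=> x [Xx [x2 r]]; rewrite /rip -/(ipEQ _ _) ipE (AredE _ _ r) E1K.
  case: r => Dx A20 _; have := disA _ Dx; rewrite -complexRe lecR.
  by rewrite hdot_pair A20 hdot0l addr0.
- by move: s0; rewrite -complexRe ltcR.
(* The lower row of the solved system says A2 = 0, which puts [x1] in [W0]. The upper row gives
   [E1inv] of A1 as s x1 - f, which lies in the subspace [X0] along with [x1] and [f]. *)
- move=> f Xf; have [[x1 x2] /= Dx e] := surj ((E1 f, 0) : X1 \oplus X2) I.
  move: e => /[dup] /(congr1 fst) /= e1 /(congr1 snd) /= e2.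
  have A20 : A2 (Q1 x1, Q2 x2) = 0.
    by apply/eqP; rewrite -oppr_eq0; move/eqP: e2; rewrite scaler0 sub0r.
  have Xx : X0 x1 by apply: subset_closure; exists x2.
  have eA : E1inv (A1 (Q1 x1, Q2 x2)) = s *: x1 - f.
    apply: (can_inj E1K'); rewrite E1K linearB linearZ /= -e1.
    by rewrite opprB addrC subrK.
  have r : red_at x1 x2.
    split=> //; rewrite eA; apply: (linear_on_domB linX0) => //.
    exact: (linear_on_domZ linX0).
  exists x1; first by split=> //; exists x2.
  by rewrite (AredE _ _ r) eA opprB addrC subrK.
Qed.
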